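(* Let $X$ be a (non-empty) complete metric space with metric $d$ and let $\mu$ be a compactly supported probability measure on $L(X)$ with $\chi_\mu<0$ and satisfying $\mathbb{E}_{g\sim\mu}[\rho(g)^t]<\infty$ for all $t\in\mathbb{R}$. Then there exists a unique probability measure $\nu$ on $X$ such that $\mu*\nu=\nu$. Moreover, there is $\alpha=\alpha(\mu)>0$ such that for every $x\in X$ there is a constant $C=C(\mu,x)>0$ such that for all $R>0$, $$\nu(\{y\in X : d(x,y)\ge R\})\le C R^{-\alpha}.$$
   Context: For a map $g:X\to X$ write $gx=g(x)$ and let $\rho(g)$ be its Lipschitz constant, i.e. the least $\rho\ge 0$ with $d(gx,gy)\le\rho\, d(x,y)$ for all $x,y\in X$ ($\rho(g)=\infty$ if there is none). $L(X)=\{g:X\to X : \rho(g)<\infty\}$ is the semigroup (under composition) of Lipschitz maps, endowed with the compact-open topology (uniform convergence on compact sets); measures on $L(X)$ and $X$ are Borel measures. ''Compactly supported'' means that the support $\mathrm{supp}(\mu)$ is a compact subset of $L(X)$ (and $\mu$ is carried by it). The contraction rate is $\chi_\mu=\mathbb{E}_{g\sim\mu}[\log\rho(g)]=\int\log\rho(g)\,d\mu(g)$. Convention: $0^t=+\infty$ for $t<0$. $X$ is not assumed locally compact or separable. For a probability measure $\nu$ on $X$, $\mu*\nu$ is the probability measure on $X$ determined by $(\mu*\nu)(f)=\int\int f(gx)\,d\mu(g)\,d\nu(x)$ for all bounded continuous $f:X\to\mathbb{R}$. *)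

(* Defs.v *)
From HB Require Import structures.
From mathcomp Require Import all_boot all_order all_algebra.
From mathcomp Require Import all_classical all_reals all_analysis.

Set Implicit Arguments.
Unset Strict Implicit.
Unset Printing Implicit Defensive.

Import Order.TTheory GRing.Theory Num.Theory.
Import numFieldTopology.Exports numFieldNormedType.Exports.

Local Open Scope classical_set_scope.
Local Open Scope ring_scope.

(* A completeMetricType is pointed, because [Complete] inherits from [Pointed];
   this is also how non-emptiness of the space is expressed. *)
#[short(type="completeMetricType")]
HB.structure Definition CompleteMetric (R : numDomainType) :=
  { T of Complete T & Metric R T }.

Section lipschitz_maps.
Context {R : realType} {X : completeMetricType R}.

Definition lip_bounds (g : X -> X) : set R :=
  [set k | 0 <= k /\ forall x y, mdist (g x) (g y) <= k * mdist x y].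

(* [ereal_inf set0 = +oo], so [lip_const g = +oo] when g is not Lipschitz;
   otherwise the infimum is attained, see [lip_const_least]. *)
Definition lip_const (g : X -> X) : \bar R :=
  ereal_inf [set k%:E | k in lip_bounds g].

Lemma lip_const_least (g : X -> X) : (lip_const g < +oo)%E ->
  exists2 k : R, lip_const g = k%:E &
    lip_bounds g k /\ (forall k', lip_bounds g k' -> k <= k').
Proof.
move=> gfin; have g0 : (0 <= lip_const g)%E.
  by apply: le_ereal_inf_tmp => _ [k [k0 _] <-]; rewrite lee_fin.
have [k kE] : exists k, lip_const g = k%:E.
  by exists (fine (lip_const g)); rewrite fineK// ge0_fin_numE.
have least k' : lip_bounds g k' -> k <= k'.
  by move=> gk'; rewrite -lee_fin -kE; apply: ereal_inf_lbound; exists k'.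
exists k => //; split => //; split; first by rewrite -lee_fin -kE.
move=> x y; have [->|xy] := eqVneq x y; first by rewrite !mdistxx mulr0.
have d0 : 0 < mdist x y by rewrite mdist_gt0.
rewrite -ler_pdivrMr// -lee_fin -kE; apply: le_ereal_inf_tmp => _ [k' [_ gk'] <-].
by rewrite lee_fin ler_pdivrMr.
Qed.

Lemma lip_const_id : (lip_const (@id X) < +oo)%E.
Proof.
apply: le_lt_trans (ltry 1); apply: ereal_inf_lbound; exists 1 => //.
by split => // x y; rewrite mul1r.
Qed.

End lipschitz_maps.

(* The space L(X), with the topology induced by the compact-open topology. *)
Definition lipMap (R : realType) (X : completeMetricType R) : Type :=
  [set g : {compact-open, X -> X} | (lip_const (g : X -> X) < +oo)%E].

HB.instance Definition _ (R : realType) (X : completeMetricType R) :=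
  Topological.on (lipMap X).

Definition lipMap_id (R : realType) (X : completeMetricType R) : lipMap X :=
  exist _ (id : {compact-open, X -> X}) (mem_set (@lip_const_id R X)).

HB.instance Definition _ (R : realType) (X : completeMetricType R) :=
  isPointed.Build (lipMap X) (lipMap_id X).

Definition lipMap_fun (R : realType) (X : completeMetricType R)
  (g : lipMap X) : X -> X := \val g.
Coercion lipMap_fun : lipMap >-> Funclass.

Definition borel (T : ptopologicalType) := g_sigma_algebraType (@open T).

Section measures.
Context {R : realType}.
Local Open Scope ereal_scope.

Definition supp (T : ptopologicalType) (mu : probability (borel T) R) : set T :=
  [set x | forall U : set T, open_nbhs x U -> 0 < mu U].

(* The second conjunct is not automatic: on a general topological space a Borel
   probability measure need not be carried by its support. *)
Definition compactly_supported (T : ptopologicalType)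
    (mu : probability (borel T) R) :=
  compact (supp mu) /\ mu (supp mu) = 1.

(* The library has [0 `^ t = 0] for [t < 0] instead of [+oo]. *)
Definition pow_pinfty (x : \bar R) (t : R) : \bar R :=
  if (x == 0) && (t < 0)%R then +oo else poweR x t.

Context {X : completeMetricType R}.

Definition contraction_rate (mu : probability (borel (lipMap X)) R) : \bar R :=
  \int[mu]_g lne (lip_const (g : lipMap X)).

(* [lam = mu * nu]. A relation, as mu * nu is characterised by its values on
   bounded continuous functions. *)
Definition is_convolution (mu : probability (borel (lipMap X)) R)
    (nu lam : probability (borel X) R) :=
  forall f : X -> R, continuous f -> bounded_fun f ->
    \int[lam]_x (f x)%:E = \int[nu]_x \int[mu]_g (f ((g : lipMap X) x))%:E.

Definition stationary (mu : probability (borel (lipMap X)) R)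
    (nu : probability (borel X) R) :=
  is_convolution mu nu nu.

End measures.

(* Main.v *)
Require Import Defs.
From HB Require Import structures.
From mathcomp Require Import all_boot all_order all_algebra.
From mathcomp Require Import all_classical all_reals all_analysis.
From mathcomp Require Import measurable_realfun.
From mathcomp Require Import ring lra.

Set Implicit Arguments.
Unset Strict Implicit.
Unset Printing Implicit Defensive.

Import Order.TTheory GRing.Theory Num.Theory.
Import numFieldTopology.Exports numFieldNormedType.Exports.

Local Open Scope classical_set_scope.
Local Open Scope ring_scope.

(** For small [t > 0] the derivative at 0 of [t |-> E[rho^t]], which is the
    contraction rate, being negative gives [kappa = E[rho^t] < 1].  The operator
    [P f x = E[f (g x)]] then multiplies [t]-Hoelder constants by [kappa], and as
    [g x] stays in a compact set when [g] ranges over the support of [mu], the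
    iterates [P^n f x] of a bounded Lipschitz [f] converge geometrically to a limit
    [c f] that does not depend on [x].  Every stationary measure integrates [f] to
    [c f], which gives uniqueness.  For existence, [c] is positive and tight: the
    iterates of [x] live on compact sets and the convergence is uniform for a given
    Hoelder constant.  So [c] is the integral against a Borel probability
    measure even though [X] is neither locally compact nor separable.  The tail
    estimate is the rate of convergence applied to [min 1 (d(x, y) / r)], whose
    [t]-Hoelder constant is [r^-t]. *)

(** * Bounded Lipschitz functions *)

(** [X] need be neither separable nor locally compact, and this shapes the proof. Positivity and
    normalisation alone do not make a functional on Lipschitz functions countably additive, so
    tightness has to be established along with convergence. The order of integration is never
    exchanged: averages of Lipschitz functions are again Lipschitz, and averages of continuous
    functions are measurable as limits of those. The mean Lipschitz constant [E[rho]] may exceed 1,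
    so Lipschitz constants can grow under iteration; functions are kept bounded Lipschitz while all
    estimates are made in the [t]-Hoelder scale, where [E[rho^t] < 1]. The moments of negative order
    make [ln rho] integrable and control the quadratic error in the expansion of [E[rho^t]] at 0,
    where small values of [rho] are as dangerous as large ones. *)

Section bounded_lipschitz.
Context {R : realType} {X : metricType R}.
Implicit Types (f g h : X -> R) (x y : X) (A : set X).

Definition bnd f := exists B, forall x, `|f x| <= B.

(** The test class throughout: a vector lattice, Hoelder for every exponent in (0, 1]
    ([blip_holder]), preserved by averaging ([blip_markov]), and large enough to determine a Borel
    probability ([blip_integral_unique]). *)
Definition blip f :=
  bnd f /\ exists L, forall x y, `|f x - f y| <= L * mdist x y.

Lemma near_mdist x (P : set X) :
  (exists2 r, 0 < r & forall y, mdist x y < r -> P y) -> \forall y \near x, P y.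
Proof.
move=> [r r0 xP]; apply/nbhs_ballP; exists r => // y.
by rewrite ballEmdist; exact: xP.
Qed.

Lemma open_mdist A x : open A -> A x ->
  exists2 r, 0 < r & forall y, mdist x y < r -> A y.
Proof.
move=> oA Ax; have /nbhs_ballP[r r0 xA] := open_nbhs_nbhs (conj oA Ax).
by exists r => // y xy; apply: xA; rewrite ballEmdist.
Qed.

Lemma modulus_continuous f (w : R -> R) :
  (forall x y, `|f x - f y| <= w (mdist x y)) ->
  (forall e, 0 < e -> exists2 r, 0 < r & forall s, 0 <= s < r -> w s <= e) ->
  continuous f.
Proof.
move=> fw w0 x; apply/cvgrPdist_le => e /w0[r r0 we].
apply: near_mdist; exists r => // y xy; apply: (le_trans (fw _ _)).
by rewrite we// mdist_ge0.
Qed.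

Lemma lipschitz_continuous f L :
  (forall x y, `|f x - f y| <= L * mdist x y) -> continuous f.
Proof.
move=> fL; apply: (@modulus_continuous _ ( *%R `|L|)) => [x y|e e0].
  by rewrite (le_trans (fL _ _))// ler_wpM2r ?mdist_ge0 ?ler_norm.
exists (e / (`|L| + 1)) => [|s /andP[s0 sr]]; first by rewrite divr_gt0// ltr_wpDl.
rewrite (@le_trans _ _ ((`|L| + 1) * s))//; first by rewrite ler_wpM2r// lerDl.
by rewrite -ler_pdivlMl ?ltr_wpDl// mulrC ltW.
Qed.

Lemma blip_continuous f : blip f -> continuous f.
Proof. by move=> [_ [L /lipschitz_continuous]]. Qed.

Lemma bnd_cst (a : R) : bnd (fun=> a).
Proof. by exists `|a|. Qed.

Lemma bndD f g : bnd f -> bnd g -> bnd (f \+ g).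
Proof.
move=> [B fB] [C gC]; exists (B + C) => x.
by rewrite (le_trans (ler_normD _ _))// lerD.
Qed.

Lemma bndZ (a : R) f : bnd f -> bnd (a \*o f).
Proof. by move=> [B fB]; exists (`|a| * B) => x; rewrite normrM ler_wpM2l. Qed.

Lemma bnd_sandwich (a b : R) f : (forall x, a <= f x <= b) -> bnd f.
Proof.
move=> fab; exists (`|a| + `|b|) => x; have /andP[fa fb] := fab x.
rewrite ler_norml; have := ler_norm b; have := ler_norm (- a).
rewrite normrN; have := normr_ge0 a; have := normr_ge0 b; lra.
Qed.

Lemma blip_cst (a : R) : blip (fun=> a).
Proof. by split; [exact: bnd_cst|exists 0 => x y; rewrite subrr normr0 mul0r]. Qed.

Lemma blipD f g : blip f -> blip g -> blip (f \+ g).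
Proof.
move=> [bf [L fL]] [bg [M gM]]; split; first exact: bndD.
exists (L + M) => x y; rewrite /= opprD addrACA (le_trans (ler_normD _ _))//.
by rewrite mulrDl lerD.
Qed.

Lemma blipZ (a : R) f : blip f -> blip (a \*o f).
Proof.
move=> [bf [L fL]]; split; first exact: bndZ.
by exists (`|a| * L) => x y; rewrite /= -mulrBr normrM -mulrA ler_wpM2l.
Qed.

Lemma blip_sum (I : Type) (s : seq I) (f : I -> X -> R) :
  (forall i, blip (f i)) -> blip (fun x => \sum_(i <- s) f i x).
Proof.
move=> bf; elim: s => [|i s ih].
  by rewrite (_ : (fun _ => _) = (fun=> 0)); [exact: blip_cst
    |apply/funext => x; rewrite big_nil].
rewrite (_ : (fun _ => _) = f i \+ (fun x => \sum_(i <- s) f i x)).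
  exact: blipD.
by apply/funext => x; rewrite big_cons.
Qed.

Lemma dist_min (a b c d : R) :
  `|Num.min a b - Num.min c d| <= `|a - c| + `|b - d|.
Proof.
have := ler_norm (a - c); have := ler_norm (b - d).
have := ler_norm (- (a - c)); have := ler_norm (- (b - d)).
rewrite !normrN; have := normr_ge0 (a - c); have := normr_ge0 (b - d).
rewrite ler_norml.
by case: (leP a b) => ?; case: (leP c d) => ?; lra.
Qed.

Lemma blip_min f g : blip f -> blip g -> blip (fun x => Num.min (f x) (g x)).
Proof.
move=> [[B fB] [L fL]] [[C gC] [M gM]]; split.
  exists (B + C) => x; have := dist_min (f x) (g x) 0 0.
  rewrite minxx !subr0 => /le_trans; apply; exact: lerD.
exists (L + M) => x y; rewrite (le_trans (dist_min _ _ _ _))//.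
by rewrite mulrDl lerD.
Qed.

Lemma blip_opp f : blip f -> blip (fun x => - f x).
Proof.
move=> /(blipZ (-1)); rewrite (_ : _ \*o _ = (fun x => - f x))//.
by apply/funext => x /=; rewrite mulN1r.
Qed.

Lemma blip_max f g : blip f -> blip g -> blip (fun x => Num.max (f x) (g x)).
Proof.
move=> /blip_opp bf /blip_opp bg; have /blip_opp := blip_min bf bg.
by congr blip; apply/funext => x; rewrite oppr_min !opprK.
Qed.

(** The Pasch-Hausdorff envelope: for [h] bounded below and [0 <= N], the largest [N]-Lipschitz
    minorant of [h]. It serves for indicators and for continuous functions alike. *)
Definition infconv (N : R) h x := inf (range (fun y => h y + N * mdist x y)).

Section infconv.
Variables (N B : R) (h : X -> R).
Hypotheses (N0 : 0 <= N) (hB : forall x, B <= h x).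

Lemma infconv_le x y : infconv N h x <= h y + N * mdist x y.
Proof.
apply: ge_inf; last by exists y.
by exists B => _ [z _ <-]; rewrite (le_trans (hB z))// lerDl mulr_ge0 ?mdist_ge0.
Qed.

Lemma infconv_le_id x : infconv N h x <= h x.
Proof. by have := infconv_le x x; rewrite mdistxx mulr0 addr0. Qed.

Lemma infconv_ge x (a : R) :
  (forall y, a <= h y + N * mdist x y) -> a <= infconv N h x.
Proof.
move=> ah; apply: lb_le_inf; first by exists (h x + N * mdist x x), x.
by move=> _ [y _ <-].
Qed.

Lemma infconv_lipschitz x y :
  `|infconv N h x - infconv N h y| <= N * mdist x y.
Proof.
suff H u v : infconv N h u - infconv N h v <= N * mdist u v.
  by rewrite ler_norml H andbT lerNl opprB metric_sym H.
rewrite lerBlDr -lerBlDl; apply: infconv_ge => z; rewrite lerBlDl.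
rewrite (le_trans (infconv_le u z))// addrCA lerD2l -mulrDr ler_wpM2l//.
exact: metric_triangle.
Qed.

End infconv.

(** Within distance [r] of [x] the semicontinuity hypothesis bounds [h]; further away the penalty
    [n * r] makes up for [h x - B] as soon as [n] exceeds [(h x - B) / r]. *)
Lemma infconv_lsc B h x (e : R) : (forall x, B <= h x) -> 0 < e ->
  (exists2 r, 0 < r & forall y, mdist x y < r -> h x - e <= h y) ->
  exists n0 : nat, forall n, (n0 <= n)%N -> h x - e <= infconv n%:R h x.
Proof.
move=> hB e0 [r r0 hr]; exists (Num.truncn ((h x - B) / r)).+1 => n n0n.
apply: infconv_ge => y; have [/hr hxy|rxy] := ltP (mdist x y) r.
  by rewrite (le_trans hxy)// lerDl mulr_ge0 ?mdist_ge0.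
have : (h x - B) / r <= n%:R.
  by apply: ltW; apply: lt_le_trans (truncnS_gt _) _; rewrite ler_nat.
rewrite ler_pdivrMr// => ?; have : n%:R * r <= n%:R * mdist x y by rewrite ler_wpM2l.
have := hB y; lra.
Qed.

Lemma infconv_mono N B h h' x : 0 <= N -> (forall x, B <= h x) ->
  (forall x, h x <= h' x) -> infconv N h x <= infconv N h' x.
Proof.
move=> N0 hB hh'; apply: infconv_ge => y.
by rewrite (le_trans (infconv_le N0 hB x y))// lerD2r.
Qed.

Lemma infconv_monoN N M B h x : 0 <= N -> N <= M -> (forall x, B <= h x) ->
  infconv N h x <= infconv M h x.
Proof.
move=> N0 NM hB; apply: infconv_ge => y.
by rewrite (le_trans (infconv_le N0 hB x y))// lerD2l ler_wpM2r ?mdist_ge0.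
Qed.

Lemma infconv_blip N B C h : 0 <= N -> (forall x, B <= h x <= C) ->
  blip (infconv N h).
Proof.
move=> N0 hBC; have hB x : B <= h x by have /andP[] := hBC x.
split; last by exists N; exact: infconv_lipschitz hB.
apply: (@bnd_sandwich B C) => x; apply/andP; split.
  by apply: infconv_ge => y; rewrite (le_trans (hB y))// lerDl mulr_ge0 ?mdist_ge0.
by rewrite (le_trans (infconv_le_id N0 hB x))//; have /andP[] := hBC x.
Qed.

(* A Lipschitz minorant of the indicator function of [A], increasing in [N];
   explicitly [min 1 (N * d(x, ~` A))], and 1 if [A] is the whole space. *)
Definition tent (N : R) A : X -> R := infconv N \1_A.

Lemma indic_ge0 A x : 0 <= \1_A x :> R.
Proof. by rewrite indicE. Qed.

Lemma indic_le1 A x : \1_A x <= 1 :> R.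
Proof. by rewrite indicE; case: (x \in A). Qed.

Lemma tent_le_indic N A x : 0 <= N -> tent N A x <= \1_A x.
Proof. by move=> N0; apply: infconv_le_id (indic_ge0 A) _. Qed.

Lemma tent_ge0 N A x : 0 <= N -> 0 <= tent N A x.
Proof.
by move=> N0; apply: infconv_ge => y; rewrite addr_ge0 ?indic_ge0// mulr_ge0 ?mdist_ge0.
Qed.

Lemma tent_le1 N A x : 0 <= N -> tent N A x <= 1.
Proof. by move=> N0; apply: le_trans (tent_le_indic _ _ N0) (indic_le1 _ _). Qed.

Lemma le_tent (N : R) A B x : 0 <= N -> A `<=` B -> tent N A x <= tent N B x.
Proof.
move=> N0 AB; apply: (infconv_mono x N0 (indic_ge0 A)) => y; rewrite !indicE.
have [/set_mem/AB/mem_set -> //|_] := boolP (y \in A); by case: (y \in B).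
Qed.

Lemma tent_le N A x y : 0 <= N -> ~ A y -> tent N A x <= N * mdist x y.
Proof.
move=> N0 Ay; have := infconv_le N0 (indic_ge0 A) x y.
by rewrite indicE memNset// add0r.
Qed.

Lemma tent_ge1 N A x : 0 <= N -> (forall y, ~ A y -> 1 <= N * mdist x y) ->
  1 <= tent N A x.
Proof.
move=> N0 xA; apply: infconv_ge => y; have [Ay|/xA] := pselect (A y).
  by rewrite indicE mem_set// lerDl mulr_ge0 ?mdist_ge0.
by move=> /le_trans; apply; rewrite lerDr indic_ge0.
Qed.

Lemma tent_lipschitz N A x y : 0 <= N ->
  `|tent N A x - tent N A y| <= N * mdist x y.
Proof. by move=> N0; apply: infconv_lipschitz (indic_ge0 A) _ _. Qed.

Lemma blip_tent N A : 0 <= N -> blip (tent N A).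
Proof.
move=> N0; apply: (@infconv_blip _ 0 1) => // x.
by rewrite indic_ge0 indic_le1.
Qed.

(** A slope of at least [1 / r] is enough if the [r]-ball about [x] lies in [A]. Thus tents rise to
    the indicator of an open set, which is how Lipschitz functions reach open sets. *)
Lemma tent_eventually1 A x : open A -> A x -> exists n0 : nat, forall n, (n0 <= n)%N ->
  tent n%:R A x = 1.
Proof.
move=> oA Ax; have [r r0 xA] := open_mdist oA Ax.
exists (Num.truncn (r^-1)).+1 => n n0n; apply/eqP; rewrite eq_le tent_le1//=.
apply: tent_ge1 => // y nAy; have ry : r <= mdist x y.
  by rewrite leNgt; apply/negP => /xA.
rewrite mulrC -ler_pdivrMl ?(lt_le_trans r0)// mulr1 (@le_trans _ _ r^-1)//.
  by rewrite lef_pV2// posrE (lt_le_trans r0).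
apply: ltW; apply: lt_le_trans (truncnS_gt _) _.
by rewrite ler_nat.
Qed.

End bounded_lipschitz.

(** * Riesz representation of tight functionals *)

(** Primeness of an ultrafilter: a finite union that belongs to it has a member that does. *)
Lemma ultra_seq_cover (T : Type) (I : eqType) (U : set_system T) (s : seq I)
    (B : I -> set T) : UltraFilter U ->
  U [set x | exists2 i, i \in s & B i x] -> exists i, U (B i).
Proof.
move=> UU; elim: s => [|i s ih] Us.
  by have /filter_ex[x [j]] := Us.
have [UBi|UBi] := in_ultra_setVsetC (B i) UU; first by exists i.
apply: ih; apply: filterS (filterI Us UBi) => x [[j + Bj] nBi].
by rewrite inE => /predU1P[ji|js]; [move: Bj; rewrite ji => /nBi|exists j].
Qed.

Section complete_cluster.
Context {R : realType} {X : completeMetricType R}.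

(** At each scale [1 / (k + 1)] the tail of [u] lies in finitely many balls, and an ultrafilter
    finer than the sequence selects one of them. It is therefore Cauchy and converges by
    completeness; this replaces a diagonal extraction of subsequences. *)
Lemma totally_bounded_cluster (u : nat -> X) (s : nat -> seq X) :
  (forall k n, (k < n)%N ->
    exists2 y, y \in s k & k.+1%:R * mdist (u n) y < 1 :> R) ->
  exists x : X, forall A : set X, closed A ->
    (exists n0 : nat, forall n, (n0 <= n)%N -> A (u n)) -> A x.
Proof.
move=> us; have [U [UU uU]] := ultraFilterLemma (fmap_proper_filter u eventually_filter).
have Uev (A : set X) : (exists n0 : nat, forall n, (n0 <= n)%N -> A (u n)) -> U A.
  by move=> [n0 An]; apply: uU; exists n0.
have Ucauchy : cauchy U.
  apply/(@cauchyP R) => e e0.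
  have [k ke] : exists k : nat, (k.+1%:R)^-1 <= e.
    exists (Num.truncn e^-1); rewrite -[leRHS]invrK lef_pV2 ?posrE ?invr_gt0//.
    by rewrite ltW// truncnS_gt.
  have [y Uy] : exists y, U [set z | k.+1%:R * mdist z y < 1 :> R].
    apply: (@ultra_seq_cover _ _ _ (s k)); apply: Uev; exists k.+1 => n kn.
    by have [y sy uy] := us _ _ kn; exists y.
  exists y; apply: filterS Uy => z /= zy; rewrite ballEmdist/= metric_sym.
  by apply: lt_le_trans ke; rewrite -[ltRHS]mulr1 ltr_pdivlMl.
have /cvg_ex[x Ux] : cvg U by apply/cauchy_cvgP.
exists x => A cA uA.
by apply: (@closed_cvg _ _ U _ id A) => //; exact: Uev.
Qed.

End complete_cluster.

Section tight_functional.
Context {R : realType} {X : completeMetricType R}.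
Implicit Types (c : (X -> R) -> R) (f g : X -> R).

(** The last field is tightness without compact sets: the tent is 1 at distance at least [1 / N]
    from [s], so little mass lies there. Combining scales with summable errors confines all but a
    small mass to a totally bounded set, whose closure is compact because [X] is complete. *)
Record tight_functional c : Prop := TightFunctional {
  tightD : forall f g, blip f -> blip g -> c (f \+ g) = c f + c g ;
  tightZ : forall a f, blip f -> c (a \*o f) = a * c f ;
  tight_le : forall f g, blip f -> blip g -> (forall x, f x <= g x) -> c f <= c g ;
  tight1 : c (fun=> 1) = 1 ;
  tight_finite : forall N e : R, 0 < N -> 0 < e ->
    exists s : seq X, c (tent N [set x | x \notin s]) <= e }.

Variable c : (X -> R) -> R.
Hypothesis ct : tight_functional c.

Lemma tight_cst a : c (fun=> a) = a.
Proof.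
have := tightZ ct a (blip_cst 1); rewrite tight1// mulr1 => {2}<-.
by congr c; apply/funext => x /=; rewrite mulr1.
Qed.

Lemma tight_ge0 f : blip f -> (forall x, 0 <= f x) -> 0 <= c f.
Proof.
by move=> bf f0; rewrite -(tight_cst 0); apply: tight_le => //; exact: blip_cst.
Qed.

Lemma tight_le1 f : blip f -> (forall x, f x <= 1) -> c f <= 1.
Proof.
by move=> bf f1; rewrite -(tight_cst 1); apply: tight_le => //; exact: blip_cst.
Qed.

Lemma tight_sum (I : Type) (s : seq I) (f : I -> X -> R) :
  (forall i, blip (f i)) -> c (fun x => \sum_(i <- s) f i x) = \sum_(i <- s) c (f i).
Proof.
move=> bf; elim: s => [|i s ih].
  rewrite big_nil -[RHS](tight_cst 0); congr c; apply/funext => x.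
  by rewrite big_nil.
rewrite big_cons -ih -tightD//; last exact: blip_sum.
by congr c; apply/funext => x; rewrite big_cons.
Qed.

(* Dini's argument on the compact sets provided by tightness: a sequence
   violating the conclusion would have a cluster point at which [g] does not
   tend to 0. *)
Lemma tight_smooth (g : nat -> X -> R) :
  (forall n, blip (g n)) -> (forall n x, g n x <= 1) ->
  (forall n m x, (n <= m)%N -> g m x <= g n x) ->
  (forall x e, 0 < e -> exists n, g n x < e) ->
  forall e, 0 < e -> exists n, c (g n) <= e.
Proof.
move=> bg g1 gdec g0 e e0; apply: contrapT => /forallNP cg.
have he k : 0 < e / 2 / 2 ^+ k.+1 by rewrite divr_gt0// divr_gt0.
have [s cs] := choice (fun k => tight_finite ct (ltr0Sn _ k) (he k)).
pose phi k := tent k.+1%:R [set x : X | x \notin s k].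
have bphi k : blip (phi k) by exact: blip_tent.
have cphi n : \sum_(k < n) c (phi k) <= e / 2 * (1 - 2 ^- n).
  elim: n => [|n ih]; first by rewrite big_ord0 expr0 invr1 subrr mulr0.
  rewrite big_ord_recr/= (le_trans (lerD ih (cs n)))// exprS invfM.
  have := exprn_gt0 n (@ltr0n R 2); set a := 2 ^- n; lra.
(* If no such point existed for some [n], applying [c] would give [c (g n) <= e]. As [g n <= 1],
   each [phi k] with [k < n] is below 1 at [u n], so [u n] is within [1 / (k + 1)] of [s k]. *)
have [u gu] : exists u : nat -> X, forall n, e / 2 + \sum_(k < n) phi k (u n) < g n (u n).
  suff : forall n, exists x, e / 2 + \sum_(k < n) phi k x < g n x.
    by move=> /choice[u gu]; exists u.
  move=> n; apply: contrapT => /forallNP gn; apply: (cg n).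
  apply: (@le_trans _ _ (c ((fun=> e / 2) \+ (fun x => \sum_(k < n) phi k x)))).
    apply: tight_le => //; first by apply: blipD; [exact: blip_cst|exact: blip_sum].
    by move=> x /=; rewrite leNgt; apply/negP; exact: gn.
  rewrite tightD//; [|exact: blip_cst|exact: blip_sum].
  rewrite tight_cst tight_sum//; have := cphi n.
  have /ltW : 0 < 2 ^- n :> R by rewrite invr_gt0 exprn_gt0.
  by set a := 2 ^- n => a0; nra.
have [x xA] : exists x : X, forall A : set X, closed A ->
    (exists n0 : nat, forall n, (n0 <= n)%N -> A (u n)) -> A x.
  apply: (@totally_bounded_cluster _ _ _ s) => k n kn.
  apply: contrapT => nk; have := gu n; apply/negP; rewrite -leNgt.
  apply: (le_trans (g1 _ _)).
  rewrite (bigD1 (Ordinal kn))//= ler_wpDl ?divr_ge0 ?(ltW e0)//.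
  rewrite ler_wpDr ?sumr_ge0// => [i _|]; first exact: tent_ge0.
  apply: tent_ge1 => // y /= /negP; rewrite negbK => ys; rewrite leNgt; apply/negP => uy.
  by apply: nk; exists y.
have [m] := g0 x (e / 2) ltac:(by rewrite divr_gt0).
apply/negP; rewrite -leNgt.
have /= : [set y | e / 2 <= g m y] x.
  apply: xA.
    have -> : [set y | e / 2 <= g m y] = g m @^-1` [set r | e / 2 <= r] by [].
    apply: preimage_closed; last exact: closed_ge.
    by move=> y _; exact: blip_continuous.
  exists m => n mn /=; apply: le_trans (gdec _ _ _ mn); apply: le_trans (ltW (gu n)).
  by rewrite lerDl sumr_ge0// => i _; exact: tent_ge0.
by [].
Qed.

End tight_functional.

(** * The outer measure of a tight functional *)

Section riesz.
Context {R : realType} {X : completeMetricType R}.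
Variable c : (X -> R) -> R.
Hypothesis ct : tight_functional c.
Local Open Scope ereal_scope.
Implicit Types (A U V : set X) (f g : X -> R).

Let below U : set (X -> R) :=
  [set f | blip f /\ forall x, (0 <= f x <= \1_U x)%R].

(** The content of the Riesz-Markov theorem, with Lipschitz minorants of the indicator in place of
    compactly supported functions, which may be too few here. *)
Definition open_content U : \bar R := ereal_sup [set (c f)%:E | f in below U].

Definition riesz_outer A : \bar R :=
  ereal_inf [set open_content U | U in [set U | open U /\ A `<=` U]].

Let below_tent N U : (0 <= N)%R -> below U (tent N U).
Proof.
by move=> N0; split; [exact: blip_tent|move=> x; rewrite tent_ge0// tent_le_indic].
Qed.

Let below_le1 U f x : below U f -> (f x <= 1)%R.
Proof. by move=> [_ /(_ x)/andP[_ /le_trans]]; apply; exact: indic_le1. Qed.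

Let below_ge0 U f x : below U f -> (0 <= f x)%R.
Proof. by move=> [_ /(_ x)/andP[]]. Qed.

Let below_off U f x : below U f -> ~ U x -> f x = 0%R.
Proof.
move=> [_ /(_ x)] + Ux; rewrite indicE memNset// => f01.
by apply/le_anti; rewrite andbC.
Qed.

Let belowP U f : blip f -> (forall x, (0 <= f x <= 1)%R) ->
  (forall x, ~ U x -> f x = 0%R) -> below U f.
Proof.
move=> bf f01 fU; split => // x; have /andP[-> f1] := f01 x.
rewrite indicE; have [Ux|Ux] := pselect (U x); first by rewrite mem_set.
by rewrite memNset// fU//; exact: lexx.
Qed.

Let open_content_ub U f : below U f -> (c f)%:E <= open_content U.
Proof. by move=> fU; apply: ereal_sup_ubound; exists f. Qed.

Lemma open_content_ge0 U : 0 <= open_content U.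
Proof.
apply: le_trans (open_content_ub (below_tent U ler01)).
by rewrite lee_fin (tight_ge0 ct)// => [|x]; [exact: blip_tent|exact: tent_ge0].
Qed.

Lemma open_content_le1 U : open_content U <= 1.
Proof.
apply: ge_ereal_sup => _ [f fU <-]; rewrite lee_fin (tight_le1 ct)//; first by case: fU.
by move=> x; exact: below_le1 fU.
Qed.

Lemma le_open_content U V : U `<=` V -> open_content U <= open_content V.
Proof.
move=> UV; apply: ge_ereal_sup => _ [f fU <-]; apply: open_content_ub.
apply: belowP; first by case: fU.
  by move=> x; rewrite (below_ge0 _ fU) (below_le1 _ fU).
by move=> x Vx; apply: (below_off fU) => /UV.
Qed.

(** The place where tightness enters. For [f] below the union, [f - min f (S n)] decreases to 0
    pointwise, so [tight_smooth] makes its value under [c] small; what remains is at most [S n], a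
    finite sum of tents. The index [n] is both the number of sets and the slope. *)
Lemma open_content_subadditive (U : nat -> set X) : (forall i, open (U i)) ->
  open_content (\bigcup_i U i) <= \sum_(i <oo) open_content (U i).
Proof.
move=> oU; apply: ge_ereal_sup => _ [f fU <-]; have [bf _] := fU.
pose S n x := (\sum_(i < n) tent n%:R (U i) x)%R.
have bS n : blip (S n) by apply: blip_sum => i; exact: blip_tent.
have S0 n x : (0 <= S n x)%R by apply: sumr_ge0 => i _; exact: tent_ge0.
have Smono n m x : (n <= m)%N -> (S n x <= S m x)%R.
  move=> nm; rewrite /S (big_ord_widen _ (fun i => tent n%:R (U i) x) nm).
  rewrite big_mkcond/=; apply: ler_sum => i _; case: ifP => _; last exact: tent_ge0.
  by apply: infconv_monoN (indic_ge0 (U i)); rewrite ?ler_nat.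
pose m n x := Num.min (f x) (S n x).
have bm n : blip (m n) by exact: blip_min.
pose g n := (f \+ (-1 \*o m n))%R.
have bg n : blip (g n) by apply: blipD => //; exact: blipZ.
have gE n x : g n x = (f x - m n x)%R by rewrite /g/= mulN1r.
apply/lee_addgt0Pr => e e0.
have [n cg] : exists n, (c (g n) <= e)%R.
  apply: (tight_smooth ct) => // [n x|n k x nk|x d d0].
  - rewrite gE lerBlDr (le_trans (below_le1 x fU))// lerDl /m le_min S0 andbT.
    exact: below_ge0 fU.
  - by rewrite !gE lerD2l lerN2 /m le_min ge_min lexx/= ge_min Smono// orbT.
  - have [[i _ Uix]|Ux] := pselect ((\bigcup_i U i) x); last first.
      exists 0%N; rewrite gE (below_off fU)// /m (below_off fU)//.
      by rewrite (min_idPl _)// subrr.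
    have [k kU] := tent_eventually1 (oU i) Uix.
    (* The index must exceed [i] for [U i] to take part in the sum, and reach [k] for its tent to be
       1 at [x]. *)
    exists (maxn k i.+1); rewrite gE /m (min_idPl _) ?subrr//.
    rewrite (le_trans (below_le1 x fU))// /S.
    rewrite (bigD1 (Ordinal (leq_maxr k i.+1)))//= kU ?leq_maxl//.
    by rewrite lerDl sumr_ge0// => j _; exact: tent_ge0.
have cf : c f = (c (g n) + c (m n))%R.
  rewrite -(tightD ct)//; congr c; apply/funext => x /=; first by rewrite -/(g n x) gE subrK.
rewrite cf EFinD addeC leeD ?lee_fin//.
apply: (@le_trans _ _ (\sum_(0 <= i < n) open_content (U i))); last first.
  by apply: nneseries_lim_ge => i _ _; exact: open_content_ge0.
apply: (@le_trans _ _ (c (S n))%:E).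
  by rewrite lee_fin (tight_le ct)// => x; rewrite /m ge_min lexx orbT.
rewrite /S (tight_sum ct)// => [|i]; last exact: blip_tent.
rewrite big_mkord -sumEFin; apply: lee_sum => i _.
exact/open_content_ub/below_tent.
Qed.

Lemma riesz_outer_open U : open U -> riesz_outer U = open_content U.
Proof.
move=> oU; apply/eqP; rewrite eq_le; apply/andP; split.
  by apply: ereal_inf_lbound; exists U => //; split.
by apply: le_ereal_inf_tmp => _ [V [_ UV] <-]; exact: le_open_content.
Qed.

Lemma le_riesz_outer A B : A `<=` B -> riesz_outer A <= riesz_outer B.
Proof.
move=> AB; apply: le_ereal_inf_tmp => _ [V [oV BV] <-].
by apply: ereal_inf_lbound; exists V => //; split => //; exact: subset_trans BV.
Qed.

Lemma riesz_outer_ge0 A : 0 <= riesz_outer A.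
Proof. by apply: le_ereal_inf_tmp => _ [V _ <-]; exact: open_content_ge0. Qed.

Lemma riesz_outer_fin A : riesz_outer A \is a fin_num.
Proof.
rewrite ge0_fin_numE ?riesz_outer_ge0// (@le_lt_trans _ _ 1) ?ltry//.
apply: le_trans (open_content_le1 setT).
by apply: ereal_inf_lbound; exists setT => //; split => //; exact: openT.
Qed.

Lemma riesz_outer0 : riesz_outer set0 = 0.
Proof.
rewrite riesz_outer_open; last exact: open0.
apply/eqP; rewrite eq_le open_content_ge0 andbT.
apply: ge_ereal_sup => _ [f fU <-]; rewrite (_ : f = fun=> 0%R) ?(tight_cst ct)//.
by apply/funext => x; exact: (below_off fU).
Qed.

Lemma riesz_outer_subadditive : sigma_subadditive riesz_outer.
Proof.
move=> A; apply/lee_addgt0Pr => e e0.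
apply: le_trans (epsilon_trick _ _ (ltW e0)); last exact: (fun n => riesz_outer_ge0 (A n)).
have [U HU] : {U : nat -> set X & forall n, (open (U n) /\ A n `<=` U n) /\
    open_content (U n) <= riesz_outer (A n) + (e / (2 ^ n.+1)%:R)%:E}.
  apply: (@choice _ _ (fun n U => (open U /\ A n `<=` U) /\
    open_content U <= riesz_outer (A n) + (e / (2 ^ n.+1)%:R)%:E)) => n.
  have en : (0 < e / (2 ^ n.+1)%:R)%R by rewrite divr_gt0// ltr0n expn_gt0.
  have [_ [U AU <-] /ltW] := lb_ereal_inf_adherent en (riesz_outer_fin (A n)).
  by exists U.
apply: (@le_trans _ _ (\sum_(i <oo) open_content (U i))); last first.
  by apply: lee_nneseries => [i _ _|i _]; [exact: open_content_ge0|have [] := HU i].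
apply: le_trans (open_content_subadditive _); last by move=> i; have [[]] := HU i.
rewrite -riesz_outer_open; last by apply: bigcup_open => i _; have [[]] := HU i.
apply: le_riesz_outer; apply: subset_bigcup => i _; by have [[]] := HU i.
Qed.

Definition riesz_outer_measure : {outer_measure set X -> \bar R} :=
  HB.pack riesz_outer (isOuterMeasure.Build R X riesz_outer riesz_outer0
    riesz_outer_ge0 le_riesz_outer riesz_outer_subadditive).

(* A function [f] nearly attaining [open_content (V `&` U)] is below [e] on a
   neighbourhood [W] of [V `\` U], so its truncation [max 0 (f - e)] can be added to
   any function below the indicator of [W]. *)
Lemma open_content_split U V : open U -> open V ->
  open_content (V `&` U) + riesz_outer (V `\` U) <= open_content V.
Proof.
move=> oU oV; have oc_fin W : open W -> open_content W \is a fin_num.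
  by move=> oW; rewrite -riesz_outer_open// riesz_outer_fin.
rewrite -leeBrDr ?riesz_outer_fin//; apply: ge_ereal_sup => _ [f fVU <-].
rewrite leeBrDr ?riesz_outer_fin//; apply/lee_addgt0Pr => e e0.
have [bf _] := fVU; pose W := V `&` [set x | (f x < e)%R].
have oW : open W.
  apply: openI => //; have -> : [set x | (f x < e)%R] = f @^-1` [set r | (r < e)%R] by [].
  by apply: open_comp; [move=> x _; exact: blip_continuous|exact: open_lt].
pose f' x := Num.max 0%R (f x - e)%R.
have bf' : blip f'.
  by apply: blip_max; [exact: blip_cst|apply: blipD => //; exact: blip_cst].
have cf : (c f <= c f' + e)%R.
  rewrite -[X in (_ <= _ + X)%R](tight_cst ct) -tightD//; last exact: blip_cst.
  apply: (tight_le ct) => //; first by apply: blipD => //; exact: blip_cst.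
  by move=> x /=; rewrite -lerBlDr /f' le_max lexx orbT.
have VUW : riesz_outer (V `\` U) <= open_content W.
  rewrite -riesz_outer_open//; apply: le_riesz_outer => x [Vx Ux]; split => //=.
  by rewrite (below_off fVU)// => -[].
apply: (@le_trans _ _ ((c f' + e)%:E + open_content W)).
  by rewrite leeD// lee_fin.
rewrite EFinD -addeA [e%:E + _]addeC addeA leeD2r//.
rewrite -leeBrDl//; apply: ge_ereal_sup => _ [h hW <-]; rewrite leeBrDl// -EFinD.
have [bh _] := hW; rewrite -(tightD ct)//; apply: open_content_ub.
apply: belowP => [|x|x Vx /=]; first exact: blipD.
- have [fx|fx] := leP (f x) e.
    rewrite /= /f' (max_idPl _) ?subr_le0// add0r.
    by rewrite (below_ge0 _ hW) (below_le1 _ hW).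
  rewrite /= [h x](below_off hW) ?addr0; last first.
    by move=> [_] /=; rewrite ltNge (ltW fx).
  rewrite /f' (max_idPr _) ?subr_ge0 ?(ltW fx)// lerBlDr.
  by rewrite (le_trans (below_le1 x fVU))// lerDl ltW.
- rewrite [h x](below_off hW) ?addr0; last by move=> [].
  rewrite /f' (below_off fVU); last by move=> [].
  by rewrite (max_idPl _)// sub0r lerNl oppr0 ltW.
Qed.

(** The outer measure of [A] is an infimum over open [V] containing [A], so the splitting of open
    sets by [U] passes to all sets. *)
Lemma riesz_open_caratheodory U : open U -> riesz_outer.-caratheodory U.
Proof.
move=> oU; apply: (@le_caratheodory_measurable _ _ riesz_outer_measure) => A.
apply: le_ereal_inf_tmp => _ [V [oV AV] <-].
apply: le_trans (open_content_split oU oV).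
rewrite -(riesz_outer_open (openI oV oU)) leeD//; apply: le_riesz_outer.
  exact: setSI.
exact: setSI.
Qed.

End riesz.

(** * Integrals of bounded measurable functions *)

Section probability_integral.
Context d {S : measurableType d} {R : realType}.
Variable P : probability S R.
Implicit Types f g : S -> R.

Definition bmeas f := measurable_fun setT f /\ exists B, forall x, `|f x| <= B.

Lemma bmeas_integrable f : bmeas f -> P.-integrable setT (EFin \o f).
Proof.
move=> [mf [B fB]]; apply: measurable_bounded_integrable => //.
  by rewrite -ge0_fin_numE// fin_num_measure.
by exists B; split; [exact: num_real|move=> M BM x _; exact: le_trans (ltW BM)].
Qed.

Lemma Rintegral_probability_cst (r : R) : \int[P]_(_ in setT) r = r.
Proof. by rewrite Rintegral_cst//= probability_setT mulr1. Qed.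

Lemma EFin_Rintegral f : bmeas f -> (\int[P]_x (f x)%:E = (\int[P]_x f x)%:E)%E.
Proof.
move=> /bmeas_integrable fi.
by rewrite /Rintegral fineK//; exact: integrable_fin_num fi.
Qed.

Lemma Rintegral_indicator (A : set S) : measurable A ->
  \int[P]_x (\1_A x) = fine (P A).
Proof. by move=> mA; rewrite /Rintegral integral_indic// setIT. Qed.

Lemma bmeas_RintegralD f g : bmeas f -> bmeas g ->
  \int[P]_x (f x + g x) = \int[P]_x f x + \int[P]_x g x.
Proof. by move=> mf mg; apply: RintegralD => //; exact: bmeas_integrable. Qed.

Lemma bmeas_RintegralZ (a : R) f : bmeas f ->
  \int[P]_x (a * f x) = a * \int[P]_x f x.
Proof. by move=> mf; apply: RintegralZl => //; exact: bmeas_integrable. Qed.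

Lemma bmeas_Rintegral_le f g : bmeas f -> bmeas g -> (forall x, f x <= g x) ->
  \int[P]_x f x <= \int[P]_x g x.
Proof.
by move=> mf mg fg; apply: le_Rintegral => //; exact: bmeas_integrable.
Qed.

Lemma bmeas_cst (r : R) : bmeas (fun=> r).
Proof. by split; [exact: measurable_cst|exists `|r|]. Qed.

Lemma bmeasD f g : bmeas f -> bmeas g -> bmeas (fun x => f x + g x).
Proof.
move=> [mf [B fB]] [mg [C gC]]; split; first exact: measurable_funD.
by exists (B + C) => x; rewrite (le_trans (ler_normD _ _))// lerD.
Qed.

Lemma bmeasZ (a : R) f : bmeas f -> bmeas (fun x => a * f x).
Proof.
move=> [mf [B fB]]; split; first exact: measurable_funM.
by exists (`|a| * B) => x; rewrite normrM ler_wpM2l.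
Qed.

Lemma bmeas_indic (A : set S) : measurable A -> bmeas (\1_A).
Proof.
move=> mA; split; first exact: measurable_indic.
by exists 1 => x; rewrite indicE; case: (x \in A); rewrite ?normr1 ?normr0.
Qed.

Lemma bmeas_sum (I : Type) (s : seq I) (f : I -> S -> R) :
  (forall i, bmeas (f i)) -> bmeas (fun x => \sum_(i <- s) f i x).
Proof.
move=> mf; elim: s => [|i s ih].
  by under eq_fun do rewrite big_nil; exact: bmeas_cst.
by under eq_fun do rewrite big_cons; exact: bmeasD.
Qed.

Lemma bmeas_Rintegral_sum (I : Type) (s : seq I) (f : I -> S -> R) :
  (forall i, bmeas (f i)) ->
  \int[P]_x (\sum_(i <- s) f i x) = \sum_(i <- s) \int[P]_x f i x.
Proof.
move=> mf; elim: s => [|i s ih].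
  under eq_Rintegral do rewrite big_nil.
  by rewrite big_nil Rintegral_probability_cst.
under eq_Rintegral do rewrite big_cons.
by rewrite big_cons bmeas_RintegralD ?ih//; exact: bmeas_sum.
Qed.

End probability_integral.

Section borel.
Context {T : ptopologicalType} {R : realType}.
Implicit Types f : T -> R.

Lemma open_borel (U : set T) : open U -> measurable (U : set (borel T)).
Proof. exact: sub_sigma_algebra. Qed.

Lemma continuous_borel f : continuous f -> measurable_fun setT (f : borel T -> R).
Proof.
move/continuousP => cf; apply: (measurability _ (RGenOpens.measurableE R)).
move=> _ [_ [a [b ->] <-]]; rewrite setTI; apply: open_borel.
exact/cf/interval_open.
Qed.

Lemma bmeas_continuous f : continuous f -> (exists B, forall x, `|f x| <= B) ->
  bmeas (f : borel T -> R).
Proof. by move=> /continuous_borel. Qed.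

End borel.

Section riesz_measure.
Context {R : realType} {X : completeMetricType R}.
Variable c : (X -> R) -> R.
Hypothesis ct : tight_functional c.
Implicit Types (f g : X -> R).

Lemma riesz_probability : exists nu : probability (borel X) R,
  forall U : set X, open U -> nu U = open_content c U.
Proof.
have mC (A : set X) : measurable (A : set (borel X)) ->
    (riesz_outer c).-caratheodory A.
  have : <<s @open X >> `<=` (riesz_outer_measure ct).-cara.-measurable.
    apply: smallest_sub.
      exact: (@sigma_algebra_measurable _ (caratheodory_type (riesz_outer_measure ct))).
    by move=> U oU; exact: riesz_open_caratheodory.
  exact.
pose nu : set (borel X) -> \bar R := riesz_outer c.
have nu_additive : semi_sigma_additive nu.
  move=> F mF tF mUF.
  apply: (@caratheodory_measure_sigma_additive _ _ (riesz_outer_measure ct)) => //.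
  - by move=> i; exact: mC.
  - exact: mC.
pose nu0 : {measure set (borel X) -> \bar R} := HB.pack nu
  (isMeasure.Build _ _ _ nu (riesz_outer0 ct) (riesz_outer_ge0 ct) nu_additive).
have nuT : nu setT = 1%E.
  rewrite /nu riesz_outer_open; last exact: openT.
  apply/eqP; rewrite eq_le (open_content_le1 ct)/=.
  rewrite -(tight1 ct); apply: ereal_sup_ubound; exists (fun=> 1) => //.
  split; first exact: blip_cst.
  by move=> x; rewrite ler01 indicE mem_set/=.
pose nu1 : probability (borel X) R := HB.pack nu
  (Measure.class nu0)
  (Measure_isProbability.Build _ _ _ nu0 nuT).
exists nu1 => U oU; exact: riesz_outer_open.
Qed.

End riesz_measure.

(** * The layer-cake comparison of the functional with the integral *)

Section layer_cake.
Context {R : realType}.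

(** The summands are the slices of [s] between the heights [k] and [k + 1]. They cut a function into
    pieces lying below indicators of its superlevel sets. *)
Lemma sum_clamp (s : R) n : 0 <= s ->
  \sum_(k < n) Num.max 0 (Num.min 1 (s - k%:R)) = Num.min s n%:R.
Proof.
move=> s0; elim: n => [|n ih]; first by rewrite big_ord0 (min_idPr _).
rewrite big_ord_recr/= ih -natr1.
case: (leP s n%:R) => sn; case: (leP 1 (s - n%:R)) => h1;
  case: (leP s (n%:R + 1)) => h2; try (case: (leP 0 1) => ?);
  try (case: (leP 0 (s - n%:R)) => ?); lra.
Qed.

Lemma sum_lt_le (s : R) n : 0 <= s -> \sum_(k < n) (k%:R < s)%R%:R <= s + 1.
Proof.
(* The bound by [n] is carried along for the induction: when [n < s], the new term 1 is absorbed
   because the sum so far is at most [n]. *)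
move=> s0; suff : \sum_(k < n) (k%:R < s)%R%:R <= Num.min n%:R (s + 1).
  by rewrite le_min => /andP[].
elim: n => [|n ih]; first by rewrite big_ord0 le_min lexx addr_ge0.
move: ih; rewrite big_ord_recr/= -natr1 !le_min => /andP[h1 h2].
by case: ltP => ? /=; apply/andP; split; lra.
Qed.

End layer_cake.

Section riesz_representation.
Context {R : realType} {X : completeMetricType R}.
Variable c : (X -> R) -> R.
Hypothesis ct : tight_functional c.
Implicit Types (f g : X -> R).

Lemma bmeas_blip f : blip f -> bmeas (f : borel X -> R).
Proof. by move=> bf; apply: bmeas_continuous; [exact: blip_continuous|case: bf]. Qed.

(** For [0 <= f <= 1], slicing [N * f] into pieces below the open sets [U k] gives
    [N * c f <= N * int f + 1], the 1 coming from rounding up; dividing by a large [N] leaves one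
    inequality. The reverse one is the same applied to [1 - f], and general [f] follow by an affine
    change. *)
Lemma riesz_representation : exists nu : probability (borel X) R,
  forall f, blip f -> \int[nu]_x f x = c f.
Proof.
have [nu nuE] := riesz_probability ct; exists nu.
have le01 f : blip f -> (forall x, 0 <= f x <= 1) -> c f <= \int[nu]_x f x.
  move=> bf f01; apply/ler_addgt0Pr => e e0.
  have [n ne] : exists n : nat, (n.+1%:R)^-1 <= e.
    exists (Num.truncn e^-1); rewrite -[leRHS]invrK lef_pV2 ?posrE ?invr_gt0//.
    by rewrite ltW// truncnS_gt.
  set N := n.+1; have N0 : 0 < N%:R :> R by rewrite ltr0n.
  pose fk (k : 'I_N) x := Num.max 0 (Num.min 1 (N%:R * f x - k%:R)).
  have bfk k : blip (fk k).
    apply: blip_max; first exact: blip_cst.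
    apply: blip_min; first exact: blip_cst.
    by apply: blipD; [exact: blipZ|exact: blip_cst].
  have Nf x : 0 <= N%:R * f x <= N%:R.
    by have /andP[? ?] := f01 x; rewrite mulr_ge0//= ler_piMr.
  have sfk x : \sum_(k < N) fk k x = N%:R * f x.
    by have /andP[? ?] := Nf x; rewrite sum_clamp// (min_idPl _).
  pose U (k : 'I_N) : set X := [set x | k%:R < N%:R * f x].
  have oU k : open (U k).
    have -> : U k = (N%:R \*o f) @^-1` [set r | k%:R < r] by [].
    apply: open_comp; last exact: open_gt.
    by move=> x _; apply: blip_continuous; exact: blipZ.
  have mU k : measurable (U k : set (borel X)) by exact: open_borel.
  have cfk k : c (fk k) <= \int[nu]_x (\1_(U k) x).
    rewrite Rintegral_indicator// -lee_fin fineK ?fin_num_measure// nuE//.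
    apply: ereal_sup_ubound; exists (fk k) => //; split => // x.
    rewrite indicE /fk /U; case: (ltP k%:R (N%:R * f x)) => kf.
      by rewrite mem_set// le_max lexx/= ge_max ler01 ge_min lexx.
    rewrite memNset; last by rewrite /= ltNge kf.
    by rewrite (max_idPl _) ?lexx// ge_min subr_le0 kf orbT.
  have : N%:R * c f <= N%:R * \int[nu]_x f x + 1.
    rewrite -(tightZ ct)// (_ : _ \*o f = fun x => \sum_(k < N) fk k x); last first.
      by apply/funext => x; rewrite sfk.
    rewrite (tight_sum ct)//; apply: (le_trans (ler_sum _ (fun k _ => cfk k))).
    rewrite -bmeas_RintegralZ; last exact: bmeas_blip.
    rewrite -[X in _ + X](Rintegral_probability_cst nu) -bmeas_RintegralD; last 2 first.
    - by apply: bmeasZ; exact: bmeas_blip.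
    - exact: bmeas_cst.
    rewrite -bmeas_Rintegral_sum => [|k]; last exact: bmeas_indic.
    apply: bmeas_Rintegral_le.
    - by apply: bmeas_sum => k; exact: bmeas_indic.
    - by apply: bmeasD; [apply: bmeasZ; exact: bmeas_blip|exact: bmeas_cst].
    - move=> x; have /andP[Nf0 _] := Nf x; apply: le_trans (sum_lt_le N Nf0).
      apply: ler_sum => k _; rewrite indicE /U.
      case: (ltP k%:R (N%:R * f x)) => kf; first by rewrite mem_set.
      by rewrite memNset//= ltNge kf.
  rewrite -ler_pdivlMl// mulrDr mulrA mulVf ?gt_eqF// mul1r mulr1 => /le_trans.
  by apply; rewrite lerD2l.
have eq01 f : blip f -> (forall x, 0 <= f x <= 1) -> \int[nu]_x f x = c f.
  move=> bf f01; apply/eqP; rewrite eq_le le01// andbT.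
  have bg : blip ((fun=> 1) \+ (-1 \*o f)).
    by apply: blipD; [exact: blip_cst|exact: blipZ].
  have := le01 _ bg; rewrite tightD// ?tight1// ?tightZ//; [|exact: blip_cst|exact: blipZ].
  rewrite /= bmeas_RintegralD ?bmeas_RintegralZ ?Rintegral_probability_cst//; last 3 first.
  - exact: bmeas_blip.
  - exact: bmeas_cst.
  - by apply: bmeasZ; exact: bmeas_blip.
  rewrite lerD2l !mulN1r lerN2; apply => x.
  by have /andP[? ?] := f01 x; lra.
move=> f bf; have [[B fB] _] := bf.
(* Chosen so that [(f + b) / (2 * b)] takes values in [0, 1]; the added 1 keeps the divisor positive
   when [B] is 0. *)
pose b := `|B| + 1; have b0 : 0 < b by rewrite ltr_wpDl.
pose g := ((2 * b)^-1 \*o (f \+ (fun=> b))).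
have bg : blip g by apply/blipZ/blipD => //; exact: blip_cst.
have fE : f = (2 * b \*o g) \+ (fun=> - b).
  apply/funext => x; rewrite /g/= mulrA divff ?mul1r ?addrK//.
  by rewrite gt_eqF// mulr_gt0.
have g01 x : 0 <= g x <= 1.
  have := le_trans (fB x) (ler_norm B); rewrite ler_norml => /andP[? ?].
  have b2 : 0 < 2 * b by rewrite mulr_gt0.
  rewrite /g/= ler_pdivrMl// mulr1 mulr_ge0 ?invr_ge0 ?(ltW b2)//; last by rewrite /b; lra.
  by rewrite /b/=; lra.
have b2g := blipZ (2 * b) bg; have bb := @blip_cst _ X (- b).
rewrite fE (tightD ct b2g bb) (tightZ ct _ bg) (tight_cst ct) -eq01//=.
rewrite (bmeas_RintegralD nu (bmeas_blip b2g) (bmeas_cst (- b))).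
by rewrite (bmeas_RintegralZ nu _ (bmeas_blip bg)) Rintegral_probability_cst.
Qed.

End riesz_representation.

(** * The Lipschitz constant as a random variable *)

Section lip_map.
Context {R : realType} {X : completeMetricType R}.
Implicit Types (g : lipMap X) (x y : X).

Lemma lipMap_eval_continuous x : continuous (fun g : lipMap X => g x).
Proof.
have ev : continuous (fun h : {compact-open, X -> X} => (h : X -> X) x).
  apply/continuousP => O oO.
  have -> : (fun h : {compact-open, X -> X} => (h : X -> X) x) @^-1` O =
      [set h | h @` [set x] `<=` O].
    by apply/seteqP; split => h /=; [move=> hO _ [_ -> <-]|move=> hO; apply: hO; exists x].
  by apply: compact_open_open => //; exact: compact_set1.
have cv : continuous (fun g : lipMap X => \val g : {compact-open, X -> X}).
  exact: initial_continuous.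
by move=> g; exact: (continuous_comp (cv g) (ev _)).
Qed.

Definition lipc g : R := fine (lip_const (g : X -> X)).

Lemma lipcP g : lip_const (g : X -> X) = (lipc g)%:E /\ lip_bounds g (lipc g) /\
  forall k, lip_bounds g k -> lipc g <= k.
Proof.
have /lip_const_least[k kE [gk kleast]] := set_valP g.
by rewrite /lipc; have -> : lip_const (g : X -> X) = k%:E by [].
Qed.

Lemma lipcE g : lip_const (g : X -> X) = (lipc g)%:E.
Proof. by have [] := lipcP g. Qed.

Lemma lipc_ge0 g : 0 <= lipc g.
Proof. by have [_ [[]]] := lipcP g. Qed.

Lemma lipc_le g x y : mdist (g x) (g y) <= lipc g * mdist x y.
Proof. by have [_ [[_ +] _]] := lipcP g; exact. Qed.

Lemma mdist_continuous (T : topologicalType) (u v : T -> X) :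
  continuous u -> continuous v -> continuous (fun t => mdist (u t) (v t)).
Proof.
move=> cu cv t; apply/cvgrPdist_le => e e0.
have e2 : 0 < e / 2 by rewrite divr_gt0.
have nu : \forall s \near t, mdist (u t) (u s) < e / 2.
  exact: (cu t _ (near_mdist (ex_intro2 _ _ (e / 2) e2 (fun y h => h)))).
have nv : \forall s \near t, mdist (v t) (v s) < e / 2.
  exact: (cv t _ (near_mdist (ex_intro2 _ _ (e / 2) e2 (fun y h => h)))).
apply: filterS2 nu nv => s /= hu hv; rewrite ler_norml.
have := metric_triangle (u t) (u s) (v t); have := metric_triangle (u s) (v s) (v t).
have := metric_triangle (u s) (u t) (v s); have := metric_triangle (u t) (v t) (v s).
rewrite (metric_sym (u s) (u t)) (metric_sym (v s) (v t)) => ? ? ? ?.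
by apply/andP; split; lra.
Qed.

(* [lipc] is a supremum of continuous functions of [g]. *)
Lemma lipc_open (k : R) : open [set g : lipMap X | k < lipc g].
Proof.
have [k0|k0] := ltP k 0.
  have -> : [set g : lipMap X | k < lipc g] = setT; last exact: openT.
  by apply/seteqP; split => // g _ /=; rewrite (lt_le_trans k0)// lipc_ge0.
have -> : [set g : lipMap X | k < lipc g] =
    \bigcup_x \bigcup_y [set g : lipMap X | k * mdist x y < mdist (g x) (g y)].
  apply/seteqP; split => g /=; last first.
    move=> [x _ [y _ /= gxy]]; have := lt_le_trans gxy (lipc_le g x y).
    by apply: contraTT; rewrite -!leNgt => ?; rewrite ler_wpM2r ?mdist_ge0.
  move=> kg; apply: contrapT => nk; have [_ [_ /(_ k)]] := lipcP g.
  suff gk : lip_bounds g k by move=> /(_ gk); rewrite leNgt kg.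
  split => // x y; rewrite leNgt; apply/negP => gxy; apply: nk.
  by exists x => //; exists y.
apply: bigcup_open => x _; apply: bigcup_open => y _.
have := mdist_continuous (@lipMap_eval_continuous x) (@lipMap_eval_continuous y).
by move/continuousP/(_ [set s | k * mdist x y < s]); apply; exact: open_gt.
Qed.

Lemma measurable_lipc : measurable_fun setT (lipc : borel (lipMap X) -> R).
Proof.
apply: (measurability _ (RGenOInfty.measurableE R)) => _ [_ [k ->] <-].
rewrite setTI; apply: open_borel.
by rewrite (_ : _ @^-1` _ = [set g : lipMap X | k < lipc g]); [exact: lipc_open
  |apply/seteqP; split => g; rewrite /= in_itv/= andbT].
Qed.

End lip_map.

(** * From a negative mean logarithm to a moment below 1 *)

Section contraction_exponent.
Context d {S : measurableType d} {R : realType}.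
Variables (P : probability S R) (r : S -> R).
Hypotheses (mr : measurable_fun setT r) (r0 : forall s, 0 <= r s).
Hypothesis moments : forall t : R, (\int[P]_s pow_pinfty (r s)%:E t < +oo)%E.

Lemma powR_le_pow_pinfty (a t : R) : ((a `^ t)%:E <= pow_pinfty a%:E t)%E.
Proof. by rewrite /pow_pinfty; case: ifP => _; rewrite ?leey. Qed.

Lemma measurable_pow_pinfty t : measurable_fun setT (fun s => pow_pinfty (r s)%:E t).
Proof.
have mrt : measurable_fun setT (fun s => (r s `^ t)%:E).
  by apply/measurable_EFinP; exact: (measurableT_comp (measurable_powR t) mr).
have [t0|t0] := boolP (t < 0); last first.
  by rewrite (_ : (fun _ => _) = (fun s => (r s `^ t)%:E))//; apply/funext => s;
    rewrite /pow_pinfty (negbTE t0) andbF.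
rewrite (_ : (fun _ => _) = (fun s => if r s == 0 then +oo%E else (r s `^ t)%:E)).
  by apply: measurable_fun_ifT => //; exact: measurable_fun_eqr.
by apply/funext => s; rewrite /pow_pinfty t0 andbT eqe.
Qed.

Lemma pow_pinfty_ge0 (a t : R) : (0 <= pow_pinfty a%:E t)%E.
Proof. by apply: le_trans (powR_le_pow_pinfty _ _); rewrite lee_fin powR_ge0. Qed.

Lemma moment_integrable (t : R) : P.-integrable setT (EFin \o (fun s => r s `^ t)).
Proof.
have mrt : measurable_fun setT (fun s => r s `^ t).
  by exact: (measurableT_comp (measurable_powR t) mr).
apply/integrableP; split; first exact/measurable_EFinP.
apply: le_lt_trans (moments t); apply: ge0_le_integral => //.
- by apply: measurableT_comp => //; exact/measurable_EFinP.
- exact: measurable_pow_pinfty.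
- by move=> s _; rewrite /= ger0_norm ?powR_ge0// powR_le_pow_pinfty.
Qed.

(** The convention [0^t = +oo] for negative [t] is what counts: the moment of order -1 would be
    infinite if [r] vanished with positive probability. *)
Lemma ae_gt0 : {ae P, forall s, 0 < r s}.
Proof.
have : P.-integrable setT (fun s => pow_pinfty (r s)%:E (-1)).
  apply/integrableP; split; first exact: measurable_pow_pinfty.
  by under eq_integral do rewrite gee0_abs ?pow_pinfty_ge0//; exact: moments.
move/(integrable_ae measurableT); apply: filterS => s /= /(_ I).
have [->|rs _] := eqVneq (r s) 0; last by rewrite lt_neqAle eq_sym rs r0.
by rewrite /pow_pinfty eqxx oppr_lt0 ltr01.
Qed.

Lemma sqr_le_expR (a : R) : 0 <= a -> a ^+ 2 <= expR (2 * a).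
Proof.
move=> a0; have ae : a <= expR a by rewrite (le_trans _ (expR_ge1Dx a))// lerDr.
by rewrite mulr_natl mulr2n expRD expr2 ler_pM.
Qed.

(** The constant 4 serves both ranges. For [a > 1/2] one has [4 * a^2 >= 1], so the remainder alone
    dominates; for [a <= 1/2] one has [expR a <= 1 / (1 - a) = 1 + a + a^2 / (1 - a)] with
    [1 / (1 - a) <= 2]. *)
Lemma expR_le_quadratic (a : R) : expR a <= 1 + a + 4 * a ^+ 2 * expR `|a|.
Proof.
have ea : 0 < expR `|a| by exact: expR_gt0.
have ea1 : 1 <= expR `|a| by rewrite -expR0 ler_expR.
have [a2|a2] := leP a (1 / 2); last first.
  have -> : `|a| = a by rewrite ger0_norm//; lra.
  have : expR a <= 4 * a ^+ 2 * expR a.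
    by rewrite ler_peMl ?expR_ge0//; nra.
  lra.
have : expR a * (1 - a) <= 1.
  have := expR_ge1Dx (- a); have := expR_gt0 a => ? h.
  have : expR a * (1 - a) <= expR a * expR (- a) by rewrite ler_wpM2l// ltW.
  by rewrite -expRD subrr expR0.
have a1 : 0 < 1 - a by lra.
rewrite -ler_pdivlMr// => /le_trans; apply.
rewrite ler_pdivrMr//.
have : a ^+ 2 <= 4 * a ^+ 2 * expR `|a| * (1 - a).
  rewrite (@le_trans _ _ (4 * a ^+ 2 * (1 - a)))//; first by nra.
  rewrite ler_wpM2r ?(ltW a1)// ler_peMr//; nra.
lra.
Qed.

(** An integrable majorant of [expR (3 * |ln r|)]. The exponent 3 is 2 + 1: two for
    [(ln r)^2 <= expR (2 * |ln r|)] and one for the factor [expR (t * |ln r|)] with [t <= 1]. *)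
Let W s := r s `^ 3 + r s `^ (-3).

Lemma expR_ln_le s : 0 < r s -> expR (3 * `|ln (r s)|) <= W s.
Proof.
move=> rs; rewrite /W /powR gt_eqF//.
have [l0|l0] := leP 0 (ln (r s)).
  by rewrite ger0_norm// lerDl expR_ge0.
by rewrite ltr0_norm// mulrN mulNr lerDr expR_ge0.
Qed.

Lemma powR_le_affine s t : 0 < t <= 1 ->
  r s `^ t <= 1 + t * ln (r s) + 4 * t ^+ 2 * W s.
Proof.
(* Where [r s = 0] the default values [ln 0 = 0] and, for positive [t], [0^t = 0] make the bound
   trivial. *)
move=> /andP[t0 t1]; have [rs|rs] := eqVneq (r s) 0.
  rewrite rs powR0 ?gt_eqF// ln0// mulr0 addr0 addr_ge0// mulr_ge0//.
    by rewrite mulr_ge0// sqr_ge0.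
  by rewrite addr_ge0// powR_ge0.
have rs0 : 0 < r s by rewrite lt_neqAle eq_sym rs r0.
rewrite {1}/powR (negbTE rs); set l := ln (r s).
apply: (le_trans (expR_le_quadratic _)); rewrite lerD2l.
apply: (@le_trans _ _ (4 * t ^+ 2 * expR (3 * `|l|))); last first.
  by rewrite ler_wpM2l ?expR_ln_le// mulr_ge0// sqr_ge0.
have -> : 4 * (t * l) ^+ 2 * expR `|t * l| = 4 * t ^+ 2 * (l ^+ 2 * expR `|t * l|).
  by ring.
have c0 : 0 <= 4 * t ^+ 2 by rewrite mulr_ge0// sqr_ge0.
rewrite ler_wpM2l//.
have -> : 3 * `|l| = 2 * `|l| + `|l| by ring.
rewrite expRD ler_pM ?sqr_ge0 ?expR_ge0//.
  by rewrite -[l ^+ 2]real_normK ?num_real// sqr_le_expR.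
by rewrite ler_expR normrM ger0_norm ?(ltW t0)// ler_piMl.
Qed.

Let mln : measurable_fun setT (fun s => ln (r s)).
Proof. exact: (measurableT_comp (@measurable_ln R) mr). Qed.

Let Wi : P.-integrable setT (EFin \o W).
Proof.
have -> : EFin \o W = (EFin \o (fun s => r s `^ 3)) \+ (EFin \o (fun s => r s `^ (-3))).
  by apply/funext => s.
by apply: integrableD => //; exact: moment_integrable.
Qed.

Lemma ln_integrable : P.-integrable setT (EFin \o (fun s => ln (r s))).
Proof.
apply: le_integrable Wi => //; first exact/measurable_EFinP.
move=> s _; rewrite lee_fin [leRHS]ger0_norm ?addr_ge0 ?powR_ge0//.
have [rs|rs] := eqVneq (r s) 0; first by rewrite rs ln0// normr0 addr_ge0 ?powR_ge0.
have rs0 : 0 < r s by rewrite lt_neqAle eq_sym rs r0.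
apply: le_trans (expR_ln_le rs0); apply: le_trans (expR_ge1Dx _).
by have := normr_ge0 (ln (r s)); lra.
Qed.

Lemma contraction_exponent : (\int[P]_s lne (r s)%:E < 0)%E ->
  exists2 t, 0 < t <= 1 & \int[P]_s (r s `^ t) < 1.
Proof.
(* The two logarithms can differ only where [r] vanishes, a null set by [ae_gt0]. *)
have -> : (\int[P]_s lne (r s)%:E = (\int[P]_s ln (r s))%:E)%E.
  rewrite /Rintegral fineK; last exact: integrable_fin_num ln_integrable.
  apply: ae_eq_integral => //.
  - by apply: measurable_fun_ifT; [exact: measurable_fun_ler|exact: measurable_cst
      |exact/measurable_EFinP].
  - exact/measurable_EFinP.
  - by apply: filterS ae_gt0 => s rs _; rewrite lne_EFin.
set chi := \int[P]_s ln (r s); rewrite lte_fin => chi0.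
set M := \int[P]_s W s; have M0 : 0 <= M.
  by apply: Rintegral_ge0 => s _; rewrite addr_ge0 ?powR_ge0.
(* This makes [4 * t * M < - chi / 2], so the bound [1 + t * chi + 4 * t^2 * M] falls below
   [1 + t * chi / 2 < 1]. The 1 in the denominator covers [M = 0]. *)
pose t := Num.min 1 (- chi / (8 * M + 1)).
have D0 : 0 < 8 * M + 1 by lra.
have t0 : 0 < t by rewrite lt_min ltr01/= divr_gt0// oppr_gt0.
have t1 : t <= 1 by rewrite ge_min lexx.
have tM : t * (8 * M + 1) <= - chi by rewrite -ler_pdivlMr// ge_min lexx orbT.
exists t; first by rewrite t0.
have i1 : P.-integrable setT (EFin \o (fun=> 1 : R)).
  by apply: bmeas_integrable; exact: bmeas_cst.
have i2 : P.-integrable setT (EFin \o (fun s => t * ln (r s))).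
  have -> : EFin \o (fun s => t * ln (r s)) = (fun s => t%:E * (ln (r s))%:E)%E by [].
  by apply: integrableZl => //; exact: ln_integrable.
have i3 : P.-integrable setT (EFin \o (fun s => 4 * t ^+ 2 * W s)).
  have -> : EFin \o (fun s => 4 * t ^+ 2 * W s) = (fun s => (4 * t ^+ 2)%:E * (W s)%:E)%E by [].
  by apply: integrableZl.
have i12 : P.-integrable setT (EFin \o (fun s => 1 + t * ln (r s))).
  have -> : EFin \o (fun s => 1 + t * ln (r s)) =
    (EFin \o (fun=> 1 : R)) \+ (EFin \o (fun s => t * ln (r s))) by [].
  exact: integrableD.
have i123 : P.-integrable setT (EFin \o (fun s => 1 + t * ln (r s) + 4 * t ^+ 2 * W s)).
  have -> : EFin \o (fun s => 1 + t * ln (r s) + 4 * t ^+ 2 * W s) =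
    (EFin \o (fun s => 1 + t * ln (r s))) \+ (EFin \o (fun s => 4 * t ^+ 2 * W s)) by [].
  exact: integrableD.
apply: (@le_lt_trans _ _ (\int[P]_s (1 + t * ln (r s) + 4 * t ^+ 2 * W s))).
  apply: le_Rintegral => //; first exact: moment_integrable.
  by move=> s _; apply: powR_le_affine; rewrite t0.
rewrite !RintegralD// !RintegralZl//; last exact: ln_integrable.
rewrite Rintegral_probability_cst -/chi -/M.
nra.
Qed.

End contraction_exponent.

(** * The averaging operator *)

(** [b n] is the sum of the bounds on all later increments, so the intervals from [u n - b n] to
    [u n + b n] are nested and shrink to a point. *)
Lemma geometric_cvg {R : realType} (u : nat -> R) (A k : R) :
  0 <= k < 1 -> (forall n, `|u n.+1 - u n| <= A * k ^+ n) ->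
  exists l, u @ \oo --> l /\ forall n, `|l - u n| <= A * k ^+ n / (1 - k).
Proof.
move=> /andP[k0 k1] uA; have k'0 : 0 < 1 - k by rewrite subr_gt0.
have A0 : 0 <= A by have := le_trans (normr_ge0 _) (uA 0%N); rewrite expr0 mulr1.
pose b n := A * k ^+ n / (1 - k).
have bS n : b n - b n.+1 = A * k ^+ n.
  rewrite /b exprS -mulrBl (_ : _ - _ = A * k ^+ n * (1 - k)); last by ring.
  by rewrite mulfK// gt_eqF.
have b0 n : 0 <= b n by rewrite /b divr_ge0 ?(ltW k'0)// mulr_ge0// exprn_ge0.
have hS n : u n.+1 + b n.+1 <= u n + b n /\ u n - b n <= u n.+1 - b n.+1.
  by have := uA n; have := bS n; rewrite ler_norml => <- /andP[? ?]; split; lra.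
have hi : nonincreasing_seq (fun n => u n + b n).
  by apply/nonincreasing_seqP => n; have [] := hS n.
have lo : nondecreasing_seq (fun n => u n - b n).
  by apply/nondecreasing_seqP => n; have [] := hS n.
have lohi n m : u n - b n <= u m + b m.
  have hm : u (maxn n m) + b (maxn n m) <= u m + b m by apply: hi; exact: leq_maxr.
  have hn : u n - b n <= u (maxn n m) - b (maxn n m) by apply: lo; exact: leq_maxl.
  have := b0 (maxn n m); lra.
have b_cvg : b @ \oo --> 0.
  rewrite (_ : b = fun n => A / (1 - k) * k ^+ n); last first.
    by apply/funext => n; rewrite /b mulrAC.
  rewrite -[X in _ --> X](mulr0 (A / (1 - k))).
  apply: cvgMr; apply: cvg_expr; by rewrite ger0_norm.
have hi_cvg : cvgn (fun n => u n + b n).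
  apply: nonincreasing_is_cvgn => //.
  by exists (u 0%N - b 0%N) => _ [n _ <-]; exact: lohi.
have u_cvg : u @ \oo --> limn (fun n => u n + b n).
  rewrite (_ : u = (fun n => u n + b n) \- b); last by apply/funext => n /=; rewrite addrK.
  rewrite -[X in _ --> X]subr0; apply: cvgB => //.
  rewrite (_ : (fun n => _) = (fun n => u n + b n))//.
  by apply/funext => n /=; rewrite addrK.
exists (limn (fun n => u n + b n)); split => // n.
have h1 : limn (fun n => u n + b n) <= u n + b n by exact: nonincreasing_cvgn_ge.
have h2 : u n - b n <= limn (fun n => u n + b n).
  by apply: limr_ge => //; apply: nearW => m; exact: lohi.
by rewrite ler_norml -/(b n); apply/andP; split; lra.
Qed.

Section holder.
Context {R : realType} {X : metricType R}.
Implicit Types (f : X -> R) (s L : R).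

Definition holder s L f := forall x y, `|f x - f y| <= L * mdist x y `^ s.

(** Interpolation: the oscillation is at most [B * min 1 a] with [a = L * mdist x y], and
    [min 1 a <= a^s] for [0 < s <= 1]. *)
Lemma holder_bounded_lipschitz s L B f : 0 <= L -> 0 < s <= 1 ->
  (forall x y, `|f x - f y| <= B) ->
  (forall x y, `|f x - f y| <= B * (L * mdist x y)) ->
  holder s (B * L `^ s) f.
Proof.
move=> L0 /andP[s0 s1] fB fL x y.
have B0 : 0 <= B by apply: le_trans (fB x x).
have d0 : 0 <= L * mdist x y by rewrite mulr_ge0// mdist_ge0.
rewrite -mulrA -powRM ?mdist_ge0//.
have [h|h] := leP 1 (L * mdist x y).
  apply: (le_trans (fB x y)); rewrite ler_peMr//.
  have -> : 1 = 1 `^ s :> R by rewrite powR1.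
  by apply: ge0_ler_powR; rewrite ?nnegrE ?(ltW s0).
apply: (le_trans (fL x y)); rewrite ler_wpM2l//.
have [->|d1] := eqVneq (L * mdist x y) 0; first by rewrite powR_ge0.
by apply: ger1_powR => //; rewrite lt_neqAle eq_sym d1 d0 ltW.
Qed.

Lemma blip_holder s f : 0 < s <= 1 -> blip f -> exists2 L, 0 <= L & holder s L f.
Proof.
move=> s01 [[B fB] [L fL]]; pose C := 2 * `|B| + `|L|.
have C0 : 0 <= C by rewrite addr_ge0// mulr_ge0.
exists (C * 1 `^ s); first by rewrite mulr_ge0// powR_ge0.
apply: holder_bounded_lipschitz => // x y.
  apply: (le_trans (ler_normB _ _)); have := le_trans (fB x) (ler_norm B).
  have := le_trans (fB y) (ler_norm B); have := normr_ge0 L; rewrite /C; lra.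
rewrite mul1r (le_trans (fL x y))// ler_wpM2r ?mdist_ge0//.
have := ler_norm L; have := normr_ge0 B; rewrite /C; lra.
Qed.

(** The constant depends on [N] but not on [A]. This uniformity gives tightness of the limit, and
    the power [s] of the slope gives the decay rate of the tail. *)
Lemma tent_holder s N (A : set X) : 0 <= N -> 0 < s <= 1 ->
  holder s (N `^ s) (tent N A).
Proof.
move=> N0 s01; rewrite -[N `^ s]mul1r; apply: holder_bounded_lipschitz => // x y.
  rewrite ler_norml; have := tent_ge0 A x N0; have := tent_ge0 A y N0.
  have := tent_le1 A x N0; have := tent_le1 A y N0 => ? ? ? ?.
  by apply/andP; split; lra.
by rewrite mul1r; exact: tent_lipschitz.
Qed.

End holder.

Section markov_op.
Context {R : realType} {X : completeMetricType R}.
Variable mu : probability (borel (lipMap X)) R.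
Hypothesis mu_supp : compactly_supported mu.
Hypothesis mu_moments : forall t : R,
  (\int[mu]_g pow_pinfty (lip_const (g : lipMap X)) t < +oo)%E.
Implicit Types (f : X -> R) (x y : X) (h : borel (lipMap X) -> R).

Definition markov_op f x : R := \int[mu]_g f ((g : lipMap X) x).

Lemma bmeas_eval f x : blip f -> bmeas (fun g : borel (lipMap X) => f ((g : lipMap X) x)).
Proof.
move=> bf; apply: (@bmeas_continuous (lipMap X)).
  move=> g; apply: continuous_comp; first exact: (@lipMap_eval_continuous _ _ x).
  exact: blip_continuous.
by have [[B fB] _] := bf; exists B => g.
Qed.

Lemma closed_supp : closed (supp mu : set (lipMap X)).
Proof.
rewrite -[supp mu]setCK; apply: open_closedC.
rewrite (_ : ~` _ = \bigcup_(U in [set U : set (lipMap X) | open U /\ ~ (0 < mu U)%E]) U).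
  by apply: bigcup_open => U [].
apply/seteqP; split => [g /existsNP[U /not_implyP[[oU Ug] nU]]|g [U [oU nU] Ug] /= sg].
  by exists U.
by apply: nU; apply: sg.
Qed.

(** The second half of [compactly_supported] makes the complement of the support null, so raising
    the bound there by [|B| + |a|] costs nothing. *)
Lemma Rintegral_le_supp h (a : R) : bmeas h -> (forall g, supp mu g -> h g <= a) ->
  \int[mu]_g h g <= a.
Proof.
move=> bh ha; have [_ [B hB]] := bh.
have msupp : measurable (supp mu : set (borel (lipMap X))).
  rewrite -[supp mu]setCK; apply: measurableC; apply: open_borel.
  exact: closed_openC closed_supp.
have mC : measurable (~` (supp mu) : set (borel (lipMap X))) by exact: measurableC.
have mC0 : mu (~` (supp mu)) = 0%E.
  by rewrite (probability_setC mu msupp); case: mu_supp => _ ->; rewrite subee.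
have bI := bmeasZ (`|B| + `|a|) (bmeas_indic mC).
apply: (@le_trans _ _ (\int[mu]_g (a + (`|B| + `|a|) * \1_(~` (supp mu)) g))).
  apply: bmeas_Rintegral_le => //; first by apply: bmeasD => //; exact: bmeas_cst.
  move=> g; rewrite indicE; have [sg|sg] := pselect (supp mu g).
    by rewrite memNset ?mulr0 ?addr0 ?ha//; exact.
  rewrite mem_set// mulr1; have := le_trans (ler_norm _) (hB g).
  by have := ler_norm B; have := ler_norm (- a); rewrite normrN; lra.
rewrite bmeas_RintegralD//; last exact: bmeas_cst.
rewrite bmeas_RintegralZ; last exact: bmeas_indic.
by rewrite Rintegral_indicator// mC0 mulr0 addr0 Rintegral_probability_cst.
Qed.

Lemma markovD f f' x : blip f -> blip f' ->
  markov_op (f \+ f') x = markov_op f x + markov_op f' x.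
Proof. by move=> bf bf'; apply: bmeas_RintegralD; exact: bmeas_eval. Qed.

Lemma markovZ a f x : blip f -> markov_op (a \*o f) x = a * markov_op f x.
Proof. by move=> bf; apply: bmeas_RintegralZ; exact: bmeas_eval. Qed.

Lemma markov_cst (a : R) x : markov_op (fun=> a) x = a.
Proof. exact: Rintegral_probability_cst. Qed.

Lemma le_markov f f' x : blip f -> blip f' -> (forall y, f y <= f' y) ->
  markov_op f x <= markov_op f' x.
Proof.
by move=> bf bf' ff'; apply: bmeas_Rintegral_le => //; exact: bmeas_eval.
Qed.

Lemma markov_le f x a : blip f -> (forall g : lipMap X, supp mu g -> f (g x) <= a) ->
  markov_op f x <= a.
Proof. by move=> bf fa; apply: Rintegral_le_supp => //; exact: bmeas_eval. Qed.

Definition moment s : R := \int[mu]_g (lipc (g : lipMap X) `^ s).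

Lemma lipc_moments t : (\int[mu]_g pow_pinfty (lipc (g : lipMap X))%:E t < +oo)%E.
Proof. by under eq_integral do rewrite -lipcE; exact: mu_moments. Qed.

Lemma lipc_integrable s :
  mu.-integrable setT (EFin \o (fun g : borel (lipMap X) => lipc g `^ s)).
Proof.
exact: (moment_integrable measurable_lipc lipc_moments).
Qed.

Lemma moment_ge0 s : 0 <= moment s.
Proof. by apply: Rintegral_ge0 => g _; exact: powR_ge0. Qed.

Lemma markov_holder (s L : R) f : 0 < s -> 0 <= L -> blip f -> holder s L f ->
  holder s (moment s * L) (markov_op f).
Proof.
move=> s0 L0 bf fL.
suff H x y : markov_op f x - markov_op f y <= moment s * L * mdist x y `^ s.
  by move=> x y; rewrite ler_norml H andbT lerNl opprB metric_sym H.
have bx := bmeas_eval x bf; have by' := bmeasZ (-1) (bmeas_eval y bf).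
have -> : markov_op f x - markov_op f y =
    \int[mu]_g (f ((g : lipMap X) x) + -1 * f ((g : lipMap X) y)).
  by rewrite bmeas_RintegralD// bmeas_RintegralZ ?mulN1r//; exact: bmeas_eval.
rewrite /moment -mulrA mulrC -RintegralZl//; last exact: lipc_integrable.
apply: le_Rintegral => //; first by apply: bmeas_integrable; exact: bmeasD.
- have -> : EFin \o (fun g : borel (lipMap X) => L * mdist x y `^ s * lipc g `^ s) =
    (fun g => (L * mdist x y `^ s)%:E * (lipc g `^ s)%:E)%E by [].
  by apply: integrableZl => //; exact: lipc_integrable.
- move=> g _; rewrite mulN1r (le_trans (ler_norm _))// (le_trans (fL _ _))//.
  rewrite -mulrA ler_wpM2l// mulrC -powRM ?mdist_ge0 ?lipc_ge0//.
  apply: ge0_ler_powR; rewrite ?nnegrE ?(ltW s0) ?mulr_ge0 ?mdist_ge0 ?lipc_ge0//.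
  exact: lipc_le.
Qed.

(** The case [s = 1] of [markov_holder]: the first moment is finite, possibly above 1, which
    preserves the class without contracting it. *)
Lemma blip_markov f : blip f -> blip (markov_op f).
Proof.
move=> bf; have [[B fB] _] := bf; split.
  apply: (@bnd_sandwich _ _ (- B) B) => x; rewrite -{1}(markov_cst (- B) x).
  rewrite -{2}(markov_cst B x) !le_markov ?bf//; try exact: blip_cst.
  - by move=> y; have := fB y; rewrite ler_norml => /andP[].
  - by move=> y; have := fB y; rewrite ler_norml => /andP[].
have i01 : 0 < (1 : R) <= 1 by rewrite ltr01 lexx.
have [L L0 fL] := blip_holder i01 bf.
exists (moment 1 * L) => x y.
by have := markov_holder ltr01 L0 bf fL x y; rewrite powRr1// mdist_ge0.
Qed.

Lemma blip_iter n f : blip f -> blip (iter n markov_op f).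
Proof. by move=> bf; elim: n => //= n; exact: blip_markov. Qed.

Lemma displacement_bounded x :
  exists2 D, 0 <= D & forall g : lipMap X, supp mu g -> mdist (g x) x <= D.
Proof.
have [mu_cpt _] := mu_supp.
have cd := mdist_continuous (@lipMap_eval_continuous _ _ x) (@cst_continuous (lipMap X) _ x).
have := compact_bounded (V := R^o) (continuous_compact (continuous_subspaceT cd) mu_cpt).
move=> [M [_ MA]]; exists (`|M| + 1) => [|g sg]; first by rewrite addr_ge0.
rewrite (le_trans (ler_norm _))//; apply: (MA (`|M| + 1)).
  by rewrite ltr_pwDr// ler_norm.
by exists g.
Qed.

Lemma markov_displacement (s L : R) f x D : 0 < s -> 0 <= L -> blip f -> holder s L f ->
  0 <= D -> (forall g : lipMap X, supp mu g -> mdist (g x) x <= D) ->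
  `|markov_op f x - f x| <= L * D `^ s.
Proof.
move=> s0 L0 bf fL D0 xD.
have H (g : lipMap X) : supp mu g -> `|f (g x) - f x| <= L * D `^ s.
  move=> /xD gD; apply: (le_trans (fL _ _)); rewrite ler_wpM2l//.
  by apply: ge0_ler_powR; rewrite ?nnegrE ?(ltW s0) ?mdist_ge0.
rewrite ler_norml; apply/andP; split.
  rewrite -subr_ge0 opprK addrAC subr_ge0 -lerBlDr.
  have := @markov_le (-1 \*o f) x (L * D `^ s - f x) (blipZ _ bf).
  rewrite markovZ// mulN1r => h; suff : - markov_op f x <= L * D `^ s - f x by lra.
  apply: h => g /H; rewrite ler_norml /= mulN1r => /andP[? ?]; lra.
rewrite lerBlDr; apply: markov_le => // g /H; rewrite ler_norml => /andP[_ ?]; lra.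
Qed.

Section contraction.
Variable t : R.
Hypotheses (t01 : 0 < t <= 1) (kappa1 : moment t < 1).
Let t0 : 0 < t. Proof. by have /andP[] := t01. Qed.
Let kappa := moment t.
Let kappa0 : 0 <= kappa. Proof. exact: moment_ge0. Qed.

Lemma iter_holder (L : R) f n : 0 <= L -> blip f -> holder t L f ->
  holder t (kappa ^+ n * L) (iter n markov_op f).
Proof.
move=> L0 bf fL; elim: n => [|n ih]; first by rewrite expr0 mul1r.
rewrite exprS -mulrA; apply: markov_holder => //; last exact: blip_iter.
by rewrite mulr_ge0// exprn_ge0.
Qed.

(** The base point is immaterial for bounded Lipschitz [f]: [iter_markov_cvg] gives the same limit
    at every point. *)
Definition limit_value f : R := limn (fun n => iter n markov_op f point).

(** The [n]-th iterate has Hoelder constant [kappa^n * L], so one more averaging moves its value at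
    [x] by at most [kappa^n * L * D^t], a summable increment. The same constant bounds the
    difference of the values at [x] and at [point], so the limits agree. The rate involves [f] only
    through [L]. *)
Lemma iter_markov_cvg f (L : R) x D : 0 <= L -> blip f -> holder t L f ->
  0 <= D -> (forall g : lipMap X, supp mu g -> mdist (g x) x <= D) ->
  (fun n => iter n markov_op f x) @ \oo --> limit_value f /\
  forall n, `|limit_value f - iter n markov_op f x| <= L * D `^ t * kappa ^+ n / (1 - kappa).
Proof.
move=> L0 bf fL D0 xD; have k01 : 0 <= kappa < 1 by rewrite kappa0.
have step y E : 0 <= E -> (forall g : lipMap X, supp mu g -> mdist (g y) y <= E) ->
    forall n, `|iter n.+1 markov_op f y - iter n markov_op f y| <= L * E `^ t * kappa ^+ n.
  move=> E0 yE n; rewrite mulrAC [L * _]mulrC.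
  apply: markov_displacement => //; [|exact: blip_iter|exact: iter_holder].
  by rewrite mulr_ge0// exprn_ge0.
have [l [ul uA]] := geometric_cvg k01 (step _ _ D0 xD).
suff -> : limit_value f = l by [].
have [E E0 pE] := displacement_bounded point.
have [l' [ul' _]] := geometric_cvg k01 (step _ _ E0 pE).
have ->: limit_value f = l' by rewrite /limit_value; exact: cvg_lim ul'.
have d_cvg : (fun n => kappa ^+ n * L * mdist point x `^ t) @ \oo --> (0 : R).
  rewrite (_ : (fun _ => _) = fun n => L * mdist point x `^ t * kappa ^+ n); last first.
    by apply/funext => n; rewrite -mulrA mulrC.
  rewrite -[X in _ --> X](mulr0 (L * mdist point x `^ t)).
  by apply: cvgMr; apply: cvg_expr; rewrite ger0_norm.
have z_cvg : (fun n => iter n markov_op f point - iter n markov_op f x) @ \oo --> (0 : R).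
  apply/norm_cvg0P; apply: (squeeze_cvgr _ (cvg_cst 0) d_cvg).
  by apply: nearW => n; rewrite normr_ge0/=; exact: iter_holder.
apply/eqP; rewrite -subr_eq0; apply/eqP; apply: (cvg_unique _ (cvgB ul' ul)) => //.
Qed.

End contraction.

End markov_op.

Section dominated.
Context d {S : measurableType d} {R : realType}.
Variable P : probability S R.

Lemma bmeas_dominated (f_ : nat -> S -> R) (f : S -> R) (B : R) :
  (forall n, measurable_fun setT (f_ n)) -> (forall n s, `|f_ n s| <= B) ->
  (forall s, f_ n s @[n --> \oo] --> f s) ->
  bmeas f /\ \int[P]_s f_ n s @[n --> \oo] --> \int[P]_s f s.
Proof.
move=> mf fB fcvg; have bf n : bmeas (f_ n) by split => //; exists B; exact: fB.
have mlim : measurable_fun setT f by apply: (@measurable_fun_cvg _ _ _ _ f_) => // s _.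
have bl : bmeas f.
  split => //; exists B => s; have c : `|f_ n s| @[n --> \oo] --> `|f s|.
    by apply: cvg_norm; exact: fcvg.
  rewrite -(cvg_lim _ c)//; apply: limr_le; first exact: cvgP c.
  by apply: nearW => n; exact: fB.
split => //.
have [] := @dominated_convergence _ _ _ P setT measurableT
  (fun n => EFin \o f_ n) (EFin \o f) (cst B%:E).
- by move=> n; exact/measurable_EFinP.
- exact/measurable_EFinP.
- by apply: aeW => s _; apply: cvg_EFin; [exact: nearW|exact: fcvg].
- by apply: bmeas_integrable; exact: bmeas_cst.
- by apply: aeW => s n _; rewrite lee_fin.
move=> _ _; rewrite /= (EFin_Rintegral P bl).
under eq_fun do rewrite (EFin_Rintegral P (bf _)).
by move/fine_cvg.
Qed.

End dominated.

Lemma bounded_funE {R : realType} (T : Type) (f : T -> R) :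
  bounded_fun (f : T -> R^o) <-> exists B, forall x, `|f x| <= B.
Proof.
split=> [[M [_ MB]]|[B fB]].
  by exists (`|M| + 1) => x; apply: MB => //; rewrite ltr_pwDr// ler_norm.
exists B; split; first exact: num_real.
by move=> M BM x _; exact: le_trans (ltW BM).
Qed.

(** * The limit functional: tightness, invariance and tail *)

Section limit_value.
Context {R : realType} {X : completeMetricType R}.
Variable mu : probability (borel (lipMap X)) R.
Hypothesis mu_supp : compactly_supported mu.
Hypothesis mu_moments : forall t : R,
  (\int[mu]_g pow_pinfty (lip_const (g : lipMap X)) t < +oo)%E.
Variable t : R.
Hypotheses (t01 : 0 < t <= 1) (kappa1 : moment mu t < 1).
Implicit Types (f : X -> R) (x y : X).

Let t0 : 0 < t. Proof. by have /andP[] := t01. Qed.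
Let kappa := moment mu t.
Let kappa0 : 0 <= kappa. Proof. exact: moment_ge0. Qed.
Let c := limit_value mu.
Let Q n f := iter n (markov_op mu) f.
Let bQ n f : blip f -> blip (Q n f). Proof. exact: blip_iter. Qed.

Lemma limit_valueP f x : blip f -> Q n f x @[n --> \oo] --> c f.
Proof.
move=> bf; have [L L0 fL] := blip_holder t01 bf.
have [D D0 xD] := displacement_bounded mu_supp x.
by have [] := iter_markov_cvg mu_supp mu_moments t01 kappa1 L0 bf fL D0 xD.
Qed.

Lemma iterD n f f' : blip f -> blip f' -> Q n (f \+ f') = Q n f \+ Q n f'.
Proof.
move=> bf bf'; elim: n => //= n ->; apply/funext => x /=.
by rewrite markovD//; exact: bQ.
Qed.

Lemma iterZ n a f : blip f -> Q n (a \*o f) = a \*o Q n f.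
Proof.
move=> bf; elim: n => //= n ->; apply/funext => x /=.
by rewrite markovZ//; exact: bQ.
Qed.

Lemma le_iter n f f' : blip f -> blip f' -> (forall x, f x <= f' x) ->
  forall x, Q n f x <= Q n f' x.
Proof.
move=> bf bf' ff'; elim: n => //= n ih x.
by apply: le_markov => //; exact: bQ.
Qed.

Lemma iter_cst n (a : R) : Q n (fun=> a) = fun=> a.
Proof. by elim: n => //= n ->; apply/funext => x; rewrite markov_cst. Qed.

Lemma small_powR (C e : R) : 0 <= C -> 0 < e -> exists2 r, 0 < r &
  forall s, 0 <= s < r -> C * s `^ t <= e.
Proof.
move=> C0 e0; pose a := e / (C + 1); have C1 : 0 < C + 1 by rewrite ltr_wpDl.
have a0 : 0 < a by rewrite divr_gt0.
exists (a `^ t^-1) => [|s /andP[s0 sr]]; first exact: powR_gt0.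
have : s `^ t <= a.
  rewrite -[leRHS]powRr1 ?(ltW a0)// -(mulVf (lt0r_neq0 t0)) powRrM.
  by apply: ge0_ler_powR; rewrite ?nnegrE ?powR_ge0 ?(ltW t0) ?(ltW sr).
move=> sa; apply: (@le_trans _ _ (C * a)); first by rewrite ler_wpM2l.
by rewrite /a mulrCA ler_piMr ?(ltW e0)// ler_pdivrMr// mul1r lerDl.
Qed.

(* The orbit of a point under the support of [mu] is compact, and the iterates
   of the tents are Hoelder with a constant independent of the finite set. *)
Lemma iter_tent_small (N : R) n x (e : R) : 0 < N -> 0 < e ->
  exists s : seq X, Q n (tent N [set y | y \notin s]) x <= e.
Proof.
move=> N0 + ; elim: n x e => [|n ih] x e e0.
  exists [:: x]; apply: le_trans (ltW e0); rewrite /Q/=.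
  have := @tent_le _ _ N [set y | y \notin [:: x]] x x (ltW N0).
  by rewrite mdistxx mulr0; apply; rewrite /= inE eqxx.
have e2 : 0 < e / 2 by rewrite divr_gt0.
have [F FP] := choice (fun y => ih y (e / 2) e2).
pose C := kappa ^+ n * N `^ t.
have C0 : 0 <= C by rewrite mulr_ge0 ?powR_ge0// exprn_ge0.
have [r r0 rC] := small_powR C0 e2.
have [mu_cpt _] := mu_supp.
have [D _ KD] : finite_subset_cover [set: X]
    (fun y => [set g : lipMap X | mdist (g x) y < r]) (supp mu).
  move: mu_cpt; rewrite compact_cover; apply => [y _|g _].
    have := mdist_continuous (@lipMap_eval_continuous _ _ x)
      (@cst_continuous (lipMap X) _ y).
    by move/continuousP/(_ [set s | s < r]); apply; exact: open_lt.
  by exists ((g : lipMap X) x) => //=; rewrite mdistxx.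
(* Since [s] contains [F y] for every centre [y] of the finite cover, the tent off [s] lies below
   each tent off [F y]. *)
pose s := flatten [seq F y | y <- finmap.enum_fset D].
exists s; set A := [set y | y \notin s].
have bA : blip (tent N A) by exact: blip_tent (ltW N0).
rewrite /Q/=; apply: markov_le => // [|g /KD[y yD /= gy]]; first exact: bQ.
have bF : blip (tent N [set z | z \notin F y]) by exact: blip_tent (ltW N0).
have : Q n (tent N A) y <= e / 2.
  apply: le_trans (FP y); apply: le_iter => // z; apply: le_tent (ltW N0) _.
  move=> u /=; apply: contra => uF; apply/flattenP; exists (F y) => //.
  by apply/mapP; exists y.
have := iter_holder mu_moments t01 n (powR_ge0 _ _) bA (tent_holder A (ltW N0) t01) (g x) y.
rewrite ler_norml => /andP[_]; rewrite -/kappa -/C -/(Q n _).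
have := rC (mdist (g x) y); rewrite mdist_ge0 gy => /(_ isT).
lra.
Qed.

Lemma limit_value_tight : tight_functional c.
Proof.
split.
- move=> f f' bf bf'; apply: (cvg_unique _ (limit_valueP point (blipD bf bf'))) => //.
  rewrite (_ : (fun n => _) = (fun n => Q n f point + Q n f' point)).
    by apply: cvgD; exact: limit_valueP.
  by apply/funext => n; rewrite iterD.
- move=> a f bf; apply: (cvg_unique _ (limit_valueP point (blipZ a bf))) => //.
  rewrite (_ : (fun n => _) = (fun n => a * Q n f point)).
    by apply: cvgMr; exact: limit_valueP.
  by apply/funext => n; rewrite iterZ.
- move=> f f' bf bf' ff'.
  apply: (ler_cvg_to (limit_valueP point bf) (limit_valueP point bf')).
  by apply: nearW => n; exact: le_iter.
- apply: (cvg_unique _ (limit_valueP point (blip_cst 1))) => //.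
  by rewrite (_ : (fun n => _) = (fun=> 1)); [exact: cvg_cst
    |apply/funext => n; rewrite iter_cst].
(* The distance from the [n]-th iterate to the limit is controlled for all tents of slope [N] at
   once. So [n] is fixed before the finite set, which is then provided by [iter_tent_small] for that
   [n]. *)
- move=> N e N0 e0; have e2 : 0 < e / 2 by rewrite divr_gt0.
  have [D D0 xD] := displacement_bounded mu_supp (point : X).
  have k1 : 0 < 1 - kappa by rewrite subr_gt0.
  pose C := N `^ t * D `^ t / (1 - kappa).
  have [n Cn] : exists n, C * kappa ^+ n <= e / 2.
    have : C * kappa ^+ n @[n --> \oo] --> 0.
      rewrite -[X in _ --> X](mulr0 C).
      by apply: cvgMr; apply: cvg_expr; rewrite ger0_norm.
    move=> /cvgrPdist_le/(_ _ e2)[n _ /(_ n (leqnn n))] /=.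
    by rewrite sub0r normrN => h; exists n; exact: le_trans (ler_norm _) h.
  have [s sn] := iter_tent_small n point N0 e2.
  exists s; set A := [set x | x \notin s] in sn *.
  have bA : blip (tent N A) by exact: blip_tent (ltW N0).
  have [_ /(_ n)] := iter_markov_cvg mu_supp mu_moments t01 kappa1 (powR_ge0 _ _) bA
    (tent_holder A (ltW N0) t01) D0 xD.
  rewrite ler_norml => /andP[_]; rewrite -/(Q n _) -/kappa -/c.
  by move: Cn; rewrite /C mulrAC; lra.
Qed.

Lemma limit_value_markov f : blip f -> c (markov_op mu f) = c f.
Proof.
move=> bf; apply: (cvg_unique _ (limit_valueP point (blip_markov mu_moments bf))) => //.
rewrite (_ : (fun n => _) = (fun n => Q n.+1 f point)).
  by have := limit_valueP point bf; rewrite -(cvg_shiftS (fun n => Q n f point)).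
by apply/funext => n; rewrite /Q iterSr.
Qed.

Lemma limit_value_tail x : exists2 C, 0 < C & forall r, 0 < r ->
  c (tent r^-1 [set y | y <> x]) <= C * r `^ (- t).
Proof.
have [D D0 xD] := displacement_bounded mu_supp x.
have k1 : 0 < 1 - kappa by rewrite subr_gt0.
have D1 : 0 <= D `^ t / (1 - kappa) by rewrite divr_ge0 ?powR_ge0// ltW.
exists (D `^ t / (1 - kappa) + 1) => [|r r0]; first by rewrite ltr_wpDl.
set A := [set y | y <> x]; have rV0 : 0 <= r^-1 by rewrite invr_ge0 ltW.
have bA : blip (tent r^-1 A) by exact: blip_tent.
(* The rate at [n = 0] suffices: the tent vanishes at [x], so the limit itself is at most the error
   bound. *)
have [_ /(_ 0%N)] := iter_markov_cvg mu_supp mu_moments t01 kappa1 (powR_ge0 _ _) bA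
  (tent_holder A rV0 t01) D0 xD.
rewrite ler_norml => /andP[_]; rewrite /= expr0 mulr1 -/kappa -/c.
have -> : r^-1 `^ t = r `^ (- t).
  by rewrite -powR_inv1 ?(ltW r0)// -powRrM mulN1r.
have := @tent_le _ _ r^-1 A x x rV0; rewrite mdistxx mulr0 => /(_ (fun h => h erefl)).
have := powR_ge0 r (- t); rewrite mulrDl mul1r -mulrA [_ `^ _ * (_ / _)]mulrC; lra.
Qed.

End limit_value.

(** * Stationary measures and the limit functional *)

Section stationary_measure.
Context {R : realType} {X : completeMetricType R}.
Variable mu : probability (borel (lipMap X)) R.
Hypothesis mu_supp : compactly_supported mu.
Hypothesis mu_moments : forall t : R,
  (\int[mu]_g pow_pinfty (lip_const (g : lipMap X)) t < +oo)%E.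
Variable t : R.
Hypotheses (t01 : 0 < t <= 1) (kappa1 : moment mu t < 1).
Implicit Types (nu : probability (borel X) R) (f : X -> R).
Let c := limit_value mu.

Lemma bmeas_eval_continuous f x : continuous f -> bnd f ->
  bmeas (fun g : borel (lipMap X) => f ((g : lipMap X) x)).
Proof.
move=> cf [B fB]; apply: (@bmeas_continuous (lipMap X)); last by exists B => g.
by move=> g; apply: continuous_comp; [exact: (@lipMap_eval_continuous _ _ x)|exact: cf].
Qed.

Lemma integral_markov_op nu f : continuous f -> bnd f -> bmeas (markov_op mu f : borel X -> R) ->
  (\int[nu]_x \int[mu]_g (f ((g : lipMap X) x))%:E = (\int[nu]_x markov_op mu f x)%:E)%E.
Proof.
move=> cf bf bm; rewrite -(EFin_Rintegral nu bm); apply: eq_integral => x _.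
by rewrite (EFin_Rintegral mu (bmeas_eval_continuous x cf bf)).
Qed.

Lemma infconv_pointwise_cvg f x : continuous f -> bnd f ->
  infconv n%:R f x @[n --> \oo] --> f x.
Proof.
move=> cf [B fB]; have fB' y : - B <= f y by have := fB y; rewrite ler_norml => /andP[].
apply/cvgrPdist_le => e e0.
have [r r0 xr] : exists2 r, 0 < r & forall y, mdist x y < r -> f x - e <= f y.
  have /cvgrPdist_le/(_ e e0)/nbhs_ballP[r r0 xr] := cf x.
  exists r => // y xy; have := xr y; rewrite ballEmdist => /(_ xy) /=.
  by rewrite ler_norml => /andP[_]; lra.
have [n0 hn] := infconv_lsc fB' e0 (ex_intro2 _ _ r r0 xr).
exists n0 => // n /= n0n; have := infconv_le_id (ler0n R n) fB' x.
by have := hn n n0n; rewrite ler_norml => ? ?; apply/andP; split; lra.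
Qed.

(** For Lipschitz functions stationarity is [limit_value_markov]. A bounded continuous [f] is the
    pointwise limit of its envelopes [h n], and dominated convergence is applied first in [g], then
    in [x]; the first limit also yields the measurability of [markov_op mu f]. *)
Lemma limit_value_stationary nu : (forall f, blip f -> \int[nu]_x f x = c f) ->
  stationary mu nu.
Proof.
move=> nuE f cf /bounded_funE bf; have [B fB] := bf.
have fB2 x : - B <= f x <= B by rewrite -ler_norml.
have fB' x : - B <= f x by have /andP[] := fB2 x.
pose h n := infconv n%:R f.
have bh n : blip (h n) by apply: infconv_blip (ler0n R n) fB2.
have hB n x : `|h n x| <= B.
  rewrite ler_norml (le_trans (infconv_le_id (ler0n R n) fB' x))//; last by have /andP[] := fB2 x.
  rewrite andbT; apply: infconv_ge => y; rewrite (le_trans (fB' y))// lerDl.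
  by rewrite mulr_ge0// mdist_ge0.
have hf x : h n x @[n --> \oo] --> f x by exact: infconv_pointwise_cvg.
have mh n : measurable_fun setT (h n : borel X -> R) by have [] := bmeas_blip (bh n).
have [bmf nuf] := bmeas_dominated nu mh hB hf.
have muf x : markov_op mu (h n) x @[n --> \oo] --> markov_op mu f x.
  have me n : measurable_fun setT (fun g : borel (lipMap X) => h n ((g : lipMap X) x)).
    by have [] := bmeas_eval x (bh n).
  by have [_] := bmeas_dominated mu me (fun n g => hB n ((g : lipMap X) x))
    (fun g => hf ((g : lipMap X) x)).
have mB n x : `|markov_op mu (h n) x| <= B.
  rewrite ler_norml -{1}(markov_cst mu (- B) x) -{2}(markov_cst mu B x).
  by apply/andP; split; apply: le_markov => //; try exact: blip_cst;
    move=> y; have := hB n y; rewrite ler_norml => /andP[].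
have mm n : measurable_fun setT (markov_op mu (h n) : borel X -> R).
  by have [] := bmeas_blip (blip_markov mu_moments (bh n)).
have [bmm num] := bmeas_dominated nu mm mB muf.
rewrite (integral_markov_op nu cf bf bmm) (EFin_Rintegral nu bmf); congr EFin.
apply: (cvg_unique _ nuf) => //; rewrite (_ : (fun n => _) =
  fun n => \int[nu]_x markov_op mu (h n) x)//; apply/funext => n.
rewrite !nuE//; last exact: blip_markov.
exact: (esym (limit_value_markov mu_supp mu_moments t01 kappa1 (bh n))).
Qed.

(** All iterates of [f] have the same integral against [nu], and they converge boundedly to the
    constant [c f]. *)
Lemma stationary_limit_value nu f : stationary mu nu -> blip f ->
  \int[nu]_x f x = c f.
Proof.
move=> nuS bf; have bQ n : blip (iter n (markov_op mu) f) by exact: blip_iter.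
have nuQ n : \int[nu]_x iter n (markov_op mu) f x = \int[nu]_x f x.
  elim: n => // n <-; apply: EFin_inj; have [bb _] := bQ n.
  have cb := blip_continuous (bQ n).
  rewrite /= -(integral_markov_op nu cb bb); last exact: bmeas_blip (bQ n.+1).
  rewrite -nuS//; last exact/bounded_funE.
  by rewrite (EFin_Rintegral nu (bmeas_blip (bQ n))).
have [[B fB] _] := bf.
have QB n x : `|iter n (markov_op mu) f x| <= B.
  rewrite ler_norml; elim: n x => [|n ih] x; first by rewrite -ler_norml.
  rewrite -{1}(markov_cst mu (- B) x) -{2}(markov_cst mu B x).
  by apply/andP; split; apply: le_markov => //; try exact: blip_cst;
    try exact: (bQ n); move=> y; have /andP[] := ih y.
have mQ n : measurable_fun setT (iter n (markov_op mu) f : borel X -> R).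
  by have [] := bmeas_blip (bQ n).
have [_ nuc] := bmeas_dominated nu mQ QB
  (fun x => limit_valueP mu_supp mu_moments t01 kappa1 x bf).
rewrite Rintegral_probability_cst in nuc.
apply: (cvg_unique _ _ nuc) => //.
by rewrite (_ : (fun n => _) = (fun=> \int[nu]_x f x)); [exact: cvg_cst
  |apply/funext => n; rewrite nuQ].
Qed.

(** Tents rise to the indicators of open sets, and open sets are stable under intersection and
    generate the Borel sets. *)
Lemma blip_integral_unique nu nu' :
  (forall f, blip f -> \int[nu]_x f x = \int[nu']_x f x) ->
  forall A : set (borel X), measurable A -> nu A = nu' A.
Proof.
move=> nunu' A mA.
have openE (U : set X) : open U -> nu U = nu' U.
  move=> oU; have mU := open_borel oU.
  have tU x : tent n%:R U x @[n --> \oo] --> (\1_U x : R).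
    have [Ux|Ux] := pselect (U x).
      have [n0 hn] := tent_eventually1 oU Ux; rewrite indicE mem_set//.
      apply: cvg_near_cst; exists n0 => // n /= /hn ->; exact.
    rewrite indicE memNset//; apply: cvg_near_cst; apply: nearW => n.
    apply/le_anti; rewrite tent_ge0// andbT.
    by have := tent_le_indic U x (ler0n R n); rewrite indicE memNset.
  have tB n x : `|tent n%:R U x| <= 1 by rewrite ger0_norm ?tent_ge0// tent_le1.
  have mt n : measurable_fun setT (tent n%:R U : borel X -> R).
    by have [] := bmeas_blip (blip_tent U (ler0n R n)).
  have [_ h] := bmeas_dominated nu mt tB tU.
  have [_ h'] := bmeas_dominated nu' mt tB tU.
  have : \int[nu]_x (\1_U x) = \int[nu']_x (\1_U x).
    apply: (cvg_unique _ h) => //; rewrite (_ : (fun n => _) =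
      fun n => \int[nu']_x tent n%:R U x)//.
    by apply/funext => n; rewrite nunu'//; exact: blip_tent.
  rewrite !Rintegral_indicator// => nuU.
  by rewrite -[LHS]fineK ?fin_num_measure// nuU fineK ?fin_num_measure.
apply: (@measure_unique _ R (borel X) (@open X) (fun=> setT) _ _ _ _ nu nu') => //.
- by move=> U V; exact: openI.
- by move=> _; exact: openT.
- by rewrite bigcup_const.
- by move=> k; rewrite -ge0_fin_numE// fin_num_measure.
Qed.

End stationary_measure.

Theorem theorem1p1 (R : realType) (X : completeMetricType R)
    (mu : probability (borel (lipMap X)) R)
    (mu_supp : compactly_supported mu)
    (mu_contr : (contraction_rate mu < 0)%E)
    (mu_moments : forall t : R,
      (\int[mu]_g pow_pinfty (lip_const (g : lipMap X)) t < +oo)%E) :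
  exists nu : probability (borel X) R,
    [/\ stationary mu nu,
        (forall nu' : probability (borel X) R, stationary mu nu' ->
           forall A : set (borel X), measurable A -> nu' A = nu A) &
        exists2 alpha : R, 0 < alpha &
          forall x : X, exists2 C : R, 0 < C &
            forall r : R, 0 < r ->
              (nu [set y : X | (r <= mdist x y)%R] <= (C * r `^ (- alpha))%:E)%E].
Proof.
have [t t01 kappa1] : exists2 t, 0 < t <= 1 & moment mu t < 1.
  apply: (contraction_exponent measurable_lipc) => [g||].
  - exact: lipc_ge0.
  - exact: lipc_moments.
  - by under eq_integral do rewrite -lipcE.
have ct := limit_value_tight mu_supp mu_moments t01 kappa1.
have [nu nuE] := riesz_representation ct; exists nu; split.
- exact: (limit_value_stationary mu_supp mu_moments t01 kappa1).
- move=> nu' nuS'; apply: blip_integral_unique => f bf.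
  by rewrite nuE// (stationary_limit_value mu_supp mu_moments t01 kappa1 nuS' bf).
(* The tail exponent is the contraction exponent [t], obtained from [mu] before any point [x] is
   given. *)
exists t => [|x]; first by have /andP[] := t01.
have [C C0 xC] := limit_value_tail mu_supp mu_moments t01 kappa1 x.
exists C => // r r0; have rV0 : 0 <= r^-1 by rewrite invr_ge0 ltW.
have mA : measurable ([set y : X | r <= mdist x y] : set (borel X)).
  rewrite -[X in measurable X]setCK; apply: measurableC; apply: open_borel.
  rewrite (_ : ~` _ = (fun y => mdist x y) @^-1` [set s | s < r]).
    apply: open_comp; last exact: open_lt.
    have cid : continuous (@id X) by move=> z; exact: cvg_id.
    by move=> y _; exact: (mdist_continuous (@cst_continuous X X x) cid).
  by apply/seteqP; split => y /=; rewrite ltNge => /negP.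
have bA := blip_tent [set y | y <> x] rV0.
have := xC r r0; rewrite -nuE// -lee_fin; apply: le_trans.
rewrite -[leLHS]fineK ?fin_num_measure// -Rintegral_indicator// lee_fin.
apply: bmeas_Rintegral_le; [exact: bmeas_indic|exact: bmeas_blip|move=> y].
(* The tent off the single point [x] with slope [1 / r] is 1 at distance at least [r] from [x], so
   it majorises the indicator of the tail set. *)
rewrite indicE; have [ry|ry] := pselect (r <= mdist x y).
  rewrite mem_set//; apply: tent_ge1 => // z /= /contrapT ->.
  by rewrite metric_sym mulrC ler_pdivlMr// mul1r.
by rewrite memNset// tent_ge0.
Qed.
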